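(* (i) Let $0<\alpha<\infty$ and let $J_\alpha$ be the tri-diagonal matrix with parameters $a_\alpha(n)$ and $b_\alpha(n)$ defined in the context, considered as an operator on $\ell^2(\mathbb{N})$ with domain \[\operatorname{Dom} J_\alpha=\{x\in\ell^2 : J_\alpha x\in\ell^2\}.\] Then $J_\alpha$ is self-adjoint and positive semi-definite. (ii) $J_\alpha$ is invertible with inverse $K_\alpha$. (iii) Let $k(x,y)$ be a real-valued continuous function of $x>0$ and $y>0$, homogeneous of degree $-1$, i.e. $k(\lambda x,\lambda y)=\lambda^{-1}k(x,y)$ for all $\lambda,x,y>0$. Assume that the operator $K$ on $\ell^2(\mathbb{N})$ given by the infinite matrix $\{k(n,m)\}_{n,m=1}^\infty$ is bounded. Furthermore, assume that $K$ coincides with the inverse of a Jacobi matrix. Then $K=cK_\alpha$ for some $\alpha>0$ and $c<0$.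
   Context: $\mathbb{N}=\{1,2,3,\ldots\}$ and $\ell^2=\ell^2(\mathbb{N})$. For $\alpha>0$, $K_\alpha$ is the bounded operator on $\ell^2$ given by the infinite matrix \[K_\alpha=\left(\frac{(nm)^{-\frac12+\alpha}}{[\max(n,m)]^{2\alpha}}\right)_{n,m=1}^\infty .\] Tri-diagonal matrices: given real sequences $a(n),b(n)$, $n\ge1$, let \[J=\begin{pmatrix} b(1)&a(1)&0&0&\cdots\\ a(1)&b(2)&a(2)&0&\cdots\\ 0&a(2)&b(3)&a(3)&\cdots\\ \vdots&\vdots&\vdots&\vdots&\ddots\end{pmatrix}.\] For any sequence $x$, $Jx$ denotes the matrix product, i.e. $(Jx)(1)=b(1)x(1)+a(1)x(2)$ and $(Jx)(n)=a(n-1)x(n-1)+b(n)x(n)+a(n)x(n+1)$ for $n\geq 2$. A Jacobi matrix is a (possibly unbounded) operator on $\ell^2$ given by such a matrix with all $b(n)$ real and all $a(n)$ positive; it acts by the matrix product on a domain containing all finitely supported sequences. A bounded operator $K$ on $\ell^2$ is the inverse of $J$ if $K$ maps $\ell^2$ bijectively onto $\operatorname{Dom}J$, with $JKx=x$ for all $x\in\ell^2$ and $KJx=x$ for all $x\in\operatorname{Dom}J$. The matrix $J_\alpha$ is the tri-diagonal matrix \[J_\alpha=\begin{pmatrix} b_\alpha(1)&a_\alpha(1)&0&0&\cdots\\ a_\alpha(1)&b_\alpha(2)&a_\alpha(2)&0&\cdots\\ 0&a_\alpha(2)&b_\alpha(3)&a_\alpha(3)&\cdots\\ \vdots&\vdots&\vdots&\vdots&\ddots\end{pmatrix}\]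 with parameters \[a_\alpha(n)=\frac{n^{\alpha+\frac12}(n+1)^{\alpha+\frac12}}{n^{2\alpha}-(n+1)^{2\alpha}},\qquad b_\alpha(n)=\frac{n^{2\alpha+1}\left((n+1)^{2\alpha}-(n-1)^{2\alpha}\right)}{\left((n+1)^{2\alpha}-n^{2\alpha}\right)\left(n^{2\alpha}-(n-1)^{2\alpha}\right)},\quad n\ge1.\] (The $a_\alpha(n)$ are negative, so strictly speaking $J_\alpha$ is the negative of a Jacobi matrix; this is why $c<0$ in (iii).) *)

(* Defs.v *)
(* Stdlib real numbers with Coquelicot.

   A sequence (x(n))_{n >= 1} is represented by x : nat -> C with the index
   shifted by one: [x i] is the entry x(i+1), and [idx i] is the real number
   i+1.  The same shift applies to the rows and columns of matrices.
   Equality of sequences is Leibniz equality (functional extensionality is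
   assumed to be available). *)
From Stdlib Require Import Reals.
From Coquelicot Require Import Coquelicot.

Open Scope R_scope.

Definition idx (i : nat) : R := INR (S i).

Definition l2 (x : nat -> C) : Prop := ex_series (fun n => (Cmod (x n)) ^ 2).

Definition norm2 (x : nat -> C) : R := sqrt (Series (fun n => (Cmod (x n)) ^ 2)).

(* Sum of a complex series; meaningful only when the series converges. *)
Definition CSeries (u : nat -> C) : C :=
  (Series (fun n => Re (u n)), Series (fun n => Im (u n))).

Definition inner (x y : nat -> C) : C :=
  CSeries (fun n => (x n * Cconj (y n))%C).

Definition lincomb (c : C) (x y : nat -> C) : nat -> C :=
  fun n => (c * x n + y n)%C.

(* A possibly unbounded operator: only the values of [act] on [Dom] matter. *)
Record operator := Operator {
  Dom : (nat -> C) -> Prop;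
  act :> (nat -> C) -> (nat -> C)
}.

Definition linear_operator (T : operator) : Prop :=
  (forall x, Dom T x -> l2 x /\ l2 (T x)) /\
  Dom T (fun _ => RtoC 0) /\
  (forall c x y, Dom T x -> Dom T y ->
     Dom T (lincomb c x y) /\ T (lincomb c x y) = lincomb c (T x) (T y)).

Definition densely_defined (T : operator) : Prop :=
  forall x, l2 x -> forall eps, 0 < eps ->
    exists y, Dom T y /\ norm2 (fun n => (x n - y n)%C) < eps.

(* (y, z) belongs to the graph of the adjoint T^*. *)
Definition adjoint_graph (T : operator) (y z : nat -> C) : Prop :=
  l2 y /\ l2 z /\ forall x, Dom T x -> inner (T x) y = inner x z.

(* T = T^*, domains included. *)
Definition self_adjoint (T : operator) : Prop :=
  linear_operator T /\ densely_defined T /\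
  forall y z, adjoint_graph T y z <-> (Dom T y /\ T y = z).

Definition positive_semidefinite (T : operator) : Prop :=
  forall x, Dom T x -> Im (inner (T x) x) = 0 /\ 0 <= Re (inner (T x) x).

Definition bounded_operator (K : operator) : Prop :=
  linear_operator K /\ (forall x, Dom K x <-> l2 x) /\
  exists M, forall x, l2 x -> norm2 (K x) <= M * norm2 x.

Definition matrix_operator (A : nat -> nat -> R) : operator :=
  Operator l2 (fun x n => CSeries (fun m => (RtoC (A n m) * x m)%C)).

(* The first clause makes the matrix product well defined on all of l^2. *)
Definition bounded_matrix (A : nat -> nat -> R) : Prop :=
  (forall x, l2 x -> forall n,
     ex_series (V := C_R_NormedModule) (fun m => (RtoC (A n m) * x m)%C)) /\
  bounded_operator (matrix_operator A).

Definition tridiag (a b : nat -> R) (x : nat -> C) (n : nat) : C :=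
  match n with
  | O => (RtoC (b 0%nat) * x 0%nat + RtoC (a 0%nat) * x 1%nat)%C
  | S p => (RtoC (a p) * x p + RtoC (b n) * x n + RtoC (a n) * x (S n))%C
  end.

Definition finitely_supported (x : nat -> C) : Prop :=
  exists N, forall n, (N <= n)%nat -> x n = RtoC 0.

Definition jacobi_matrix (T : operator) : Prop :=
  linear_operator T /\
  (forall x, finitely_supported x -> Dom T x) /\
  exists a b : nat -> R, (forall n, 0 < a n) /\
    forall x, Dom T x -> T x = tridiag a b x.

(* K is meant to be a bounded operator on l^2; boundedness is stated
   separately. *)
Definition is_inverse (T K : operator) : Prop :=
  (forall x, l2 x -> Dom T (K x)) /\
  (forall x y, l2 x -> l2 y -> K x = K y -> x = y) /\
  (forall y, Dom T y -> exists x, l2 x /\ K x = y) /\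
  (forall x, l2 x -> T (K x) = x) /\
  (forall x, Dom T x -> K (T x) = x).

(* [Rpower 0 s] is 1 because [ln 0] is 0; the coefficient [b_alpha alpha 1]
   needs 0^s = 0 for s > 0. *)
Definition rpow (t s : R) : R := if Req_EM_T t 0 then 0 else Rpower t s.

Definition a_alpha (alpha n : R) : R :=
  rpow n (alpha + 1 / 2) * rpow (n + 1) (alpha + 1 / 2) /
  (rpow n (2 * alpha) - rpow (n + 1) (2 * alpha)).

Definition b_alpha (alpha n : R) : R :=
  rpow n (2 * alpha + 1) *
    (rpow (n + 1) (2 * alpha) - rpow (n - 1) (2 * alpha)) /
  ((rpow (n + 1) (2 * alpha) - rpow n (2 * alpha)) *
   (rpow n (2 * alpha) - rpow (n - 1) (2 * alpha))).

Definition k_alpha (alpha n m : R) : R :=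
  rpow (n * m) (- (1 / 2) + alpha) / rpow (Rmax n m) (2 * alpha).

Definition kernel_matrix (k : R -> R -> R) (n m : nat) : R := k (idx n) (idx m).

Definition J_alpha (alpha : R) : operator :=
  let J := tridiag (fun i => a_alpha alpha (idx i))
                   (fun i => b_alpha alpha (idx i)) in
  Operator (fun x => l2 x /\ l2 (J x)) J.

Definition K_alpha (alpha : R) : operator :=
  matrix_operator (kernel_matrix (k_alpha alpha)).

(* Main.v *)
Require Import Defs.
From Stdlib Require Import Reals Lra Lia FunctionalExtensionality.
From Coquelicot Require Import Coquelicot.

Open Scope R_scope.

(** For [p > 0] and a strictly decreasing [d > 0], call
    [G n m = p n * p m * d (max n m)] a Green kernel.  If [y = G x], the
    quotient [y n / p n] changes between [n] and [n+1] by
    [(d n - d (n+1)) * sum_{m <= n} p m * x m]: the terms with [m > n] cancel.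
    Hence dividing the increments of [y / p] by those of [d] gives partial sums
    of [p x], and a second difference gives back [x].  This second-order
    difference operator is tri-diagonal ([real_tridiag_green]), and for
    [p n = n^(alpha - 1/2)], [d n = n^(- 2 alpha)] the two matrices are
    [K_alpha] and [J_alpha].

    Boundedness of [K_alpha] is the Schur test with weights [n^(-1/2)]
    ([power_schur]).  A sequence annihilated by the tri-diagonal matrix is a
    multiple of [p] ([real_tridiag_kernel]), and [p] is not square-summable; so
    on its maximal domain the tri-diagonal operator is injective, and [K_alpha]
    is its two-sided inverse ([green_inverse]).  The finite sections of the form
    [<x, G y>] converge to it ([section_form_lim]), which makes [G] symmetric
    and, after a summation by parts in the finite sections, nonnegative.
    Self-adjointness and positivity then pass from a bounded symmetric operator
    to its inverse ([self_adjoint_of_inverse], [positive_of_inverse]).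

    For the converse, both [J K = 1] and [K J = 1] on unit vectors are
    three-term recurrences, for the columns and for the rows of [K].  Off the
    diagonal they are homogeneous, so each column above the diagonal and each
    row left of it is a multiple of one sequence [f] with [f 1 = 1]
    ([two_sided_inverse_triangles]).  Homogeneity fixes the diagonal to be
    [k 1 1 / n], whence [k(n, m) = k 1 1 * f n / (m * f m)] for [n <= m], and
    symmetrically ([homogeneous_inverse_factor]).  Homogeneity again forces [f]
    to be completely multiplicative, and continuity of [k(t, 1)] on [[1/2, 1]]
    bounds [f n / f m] for [n <= m <= 2 n].  A completely multiplicative
    function that is within a constant factor of a power is that power, because
    the factor can be tested on powers of [n] ([multiplicative_abs_power]);
    continuity at [1] fixes the signs.  So [f n = n^beta].  Square-summability
    of the first column says that [alpha = beta + 1/2] is positive, and the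
    upper left corner of [J K = 1] with [a 1 > 0] gives [c = k 1 1 < 0]. *)

(** * Finite sums and series of real numbers *)

Lemma is_series_iff_lim (a : nat -> R) (l : R) :
  is_series a l <-> is_lim_seq (sum_f_R0 a) l.
Proof.
  split; intros H.
  - apply is_lim_seq_ext with (sum_n a).
    + intros n. apply sum_n_Reals.
    + exact H.
  - apply (is_lim_seq_ext (sum_f_R0 a) (sum_n a)) in H.
    + exact H.
    + intros n. symmetry. apply sum_n_Reals.
Qed.

Lemma Series_lim (a : nat -> R) :
  ex_series a -> is_lim_seq (sum_f_R0 a) (Series a).
Proof. intros H. apply is_series_iff_lim, Series_correct, H. Qed.

Lemma is_series_support (a : nat -> R) (N : nat) :
  (forall n, (N < n)%nat -> a n = 0) -> is_series a (sum_f_R0 a N).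
Proof.
  intros H. apply is_series_iff_lim.
  apply is_lim_seq_ext_loc with (fun _ => sum_f_R0 a N).
  - exists N. intros n Hn. induction Hn as [|n Hn IH]; [reflexivity|].
    simpl. rewrite <- IH, H by lia. ring.
  - apply is_lim_seq_const.
Qed.

Lemma Series_support (a : nat -> R) (N : nat) :
  (forall n, (N < n)%nat -> a n = 0) -> Series a = sum_f_R0 a N.
Proof. intros H. apply is_series_unique, is_series_support, H. Qed.

Lemma ex_series_eq (a b : nat -> R) :
  (forall n, a n = b n) -> ex_series a -> ex_series b.
Proof. apply (ex_series_ext (V := R_NormedModule)). Qed.

Lemma sum_single (a : nat -> R) (m N : nat) :
  (m <= N)%nat -> (forall n, n <> m -> a n = 0) -> sum_f_R0 a N = a m.
Proof.
  intros Hm H. induction N as [|N IH]; simpl.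
  - replace m with 0%nat by lia. reflexivity.
  - destruct (Nat.eq_dec m (S N)) as [->|Hne].
    + rewrite (sum_eq _ (fun _ => 0)) by (intros i Hi; apply H; lia).
      rewrite sum_cte. ring.
    + rewrite IH by lia. rewrite (H (S N)) by lia. ring.
Qed.

Lemma Series_single (a : nat -> R) (m : nat) :
  (forall n, n <> m -> a n = 0) -> Series a = a m.
Proof.
  intros H. rewrite (Series_support a m) by (intros n Hn; apply H; lia).
  apply sum_single; auto.
Qed.

Lemma sum_nonneg (a : nat -> R) (N : nat) :
  (forall n, 0 <= a n) -> 0 <= sum_f_R0 a N.
Proof. intros H. apply cond_pos_sum, H. Qed.

Lemma sum_le_Series (a : nat -> R) (N : nat) :
  (forall n, 0 <= a n) -> ex_series a -> sum_f_R0 a N <= Series a.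
Proof.
  intros H Ha. apply is_lim_seq_incr_compare.
  - apply Series_lim, Ha.
  - intros n. simpl. specialize (H (S n)). lra.
Qed.

Lemma Series_nonneg (a : nat -> R) :
  (forall n, 0 <= a n) -> ex_series a -> 0 <= Series a.
Proof.
  intros H Ha. apply Rle_trans with (sum_f_R0 a 0).
  - apply sum_nonneg, H.
  - apply sum_le_Series; assumption.
Qed.

Lemma Series_le_bound (a : nat -> R) (B : R) :
  ex_series a -> (forall N, sum_f_R0 a N <= B) -> Series a <= B.
Proof.
  intros Ha H.
  apply (is_lim_seq_le (sum_f_R0 a) (fun _ => B) (Series a) B H).
  - apply Series_lim, Ha.
  - apply is_lim_seq_const.
Qed.

Lemma ex_series_bounded (a : nat -> R) (B : R) :
  (forall n, 0 <= a n) -> (forall N, sum_f_R0 a N <= B) -> ex_series a.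
Proof.
  intros H HB.
  destruct (ex_finite_lim_seq_incr (sum_f_R0 a) B) as [l Hl].
  - intros n. simpl. specialize (H (S n)). lra.
  - exact HB.
  - exists l. apply is_series_iff_lim, Hl.
Qed.

Lemma sum_scal (c : R) (a : nat -> R) (N : nat) :
  sum_f_R0 (fun n => c * a n) N = c * sum_f_R0 a N.
Proof.
  rewrite scal_sum. apply sum_eq. intros. ring.
Qed.

Lemma sum_exchange (f : nat -> nat -> R) (N M : nat) :
  sum_f_R0 (fun n => sum_f_R0 (f n) M) N =
  sum_f_R0 (fun m => sum_f_R0 (fun n => f n m) N) M.
Proof.
  induction N as [|N IH]; simpl; [reflexivity|].
  rewrite IH, <- sum_plus. reflexivity.
Qed.

Lemma is_lim_seq_sum (f : nat -> nat -> R) (l : nat -> R) (N : nat) :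
  (forall n, is_lim_seq (f n) (l n)) ->
  is_lim_seq (fun M => sum_f_R0 (fun n => f n M) N) (sum_f_R0 l N).
Proof.
  intros H. induction N as [|N IH]; simpl; [apply H|].
  apply is_lim_seq_plus'; [exact IH|apply H].
Qed.

(** * Real square-summable sequences *)

Definition sq_summable (x : nat -> R) : Prop := ex_series (fun n => x n ^ 2).

Definition energy (x : nat -> R) : R := Series (fun n => x n ^ 2).

Lemma energy_nonneg (x : nat -> R) : sq_summable x -> 0 <= energy x.
Proof. intros H. apply Series_nonneg; [intros; apply pow2_ge_0|exact H]. Qed.

Lemma sum_sq_le_energy (x : nat -> R) (N : nat) :
  sq_summable x -> sum_f_R0 (fun n => x n ^ 2) N <= energy x.
Proof. apply sum_le_Series. intros; apply pow2_ge_0. Qed.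

Lemma sq_summable_lincomb (c : R) (x y : nat -> R) :
  sq_summable x -> sq_summable y -> sq_summable (fun n => c * x n + y n).
Proof.
  intros Hx Hy.
  (* (u + v)^2 <= 2 u^2 + 2 v^2 *)
  apply ex_series_bounded with (2 * c ^ 2 * energy x + 2 * energy y).
  - intros; apply pow2_ge_0.
  - intros N.
    apply Rle_trans with
      (sum_f_R0 (fun n => 2 * c ^ 2 * x n ^ 2 + 2 * y n ^ 2) N).
    + apply sum_Rle. intros n _. pose proof (pow2_ge_0 (c * x n - y n)). nra.
    + rewrite sum_plus, !sum_scal.
      pose proof (sum_sq_le_energy x N Hx). pose proof (sum_sq_le_energy y N Hy).
      pose proof (pow2_ge_0 c). nra.
Qed.

(** The cross term of the induction step is absorbed by the arithmetic-geometric
    mean inequality applied to [B v^2] and [C u^2], where [B], [C] are the two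
    sums so far and [u], [v] the new entries. *)
Lemma sum_cauchy_schwarz (x y : nat -> R) (N : nat) :
  sum_f_R0 (fun n => x n * y n) N ^ 2 <=
  sum_f_R0 (fun n => x n ^ 2) N * sum_f_R0 (fun n => y n ^ 2) N.
Proof.
  induction N as [|N IH]; simpl sum_f_R0; [nra|].
  pose proof (sum_nonneg (fun n => x n ^ 2) N (fun n => pow2_ge_0 (x n))) as HB.
  pose proof (sum_nonneg (fun n => y n ^ 2) N (fun n => pow2_ge_0 (y n))) as HC.
  set (A := sum_f_R0 (fun n => x n * y n) N) in *.
  set (B := sum_f_R0 (fun n => x n ^ 2) N) in *.
  set (C := sum_f_R0 (fun n => y n ^ 2) N) in *.
  set (u := x (S N)). set (v := y (S N)).
  assert (H0 : 0 <= B * v ^ 2 + C * u ^ 2) by nra.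
  assert (H1 : (2 * A * (u * v)) ^ 2 <= (B * v ^ 2 + C * u ^ 2) ^ 2).
  { pose proof (pow2_ge_0 (B * v ^ 2 - C * u ^ 2)).
    pose proof (Rmult_le_compat_r ((u * v) ^ 2) _ _ (pow2_ge_0 _) IH). nra. }
  assert (H2 : 2 * A * (u * v) <= B * v ^ 2 + C * u ^ 2).
  { apply Rsqr_incr_0_var; [|exact H0]. unfold Rsqr. nra. }
  clear H0 H1. change ((A + u * v) ^ 2 <= (B + u ^ 2) * (C + v ^ 2)).
  replace ((A + u * v) ^ 2) with (A ^ 2 + 2 * A * (u * v) + u ^ 2 * v ^ 2) by ring.
  replace ((B + u ^ 2) * (C + v ^ 2)) with
    (B * C + (B * v ^ 2 + C * u ^ 2) + u ^ 2 * v ^ 2) by ring.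
  lra.
Qed.

Lemma ex_series_mult_sq (x y : nat -> R) :
  sq_summable x -> sq_summable y -> ex_series (fun n => x n * y n).
Proof.
  intros Hx Hy. apply ex_series_Rabs.
  apply ex_series_bounded with (energy x + energy y).
  - intros; apply Rabs_pos.
  - intros N. apply Rle_trans with (sum_f_R0 (fun n => x n ^ 2 + y n ^ 2) N).
    + apply sum_Rle. intros n _. unfold Rabs. destruct Rcase_abs; nra.
    + rewrite sum_plus. apply Rplus_le_compat; apply sum_sq_le_energy; assumption.
Qed.

(** * Bounded symmetric matrices: the Schur test *)

Definition rmat (A : nat -> nat -> R) (x : nat -> R) (n : nat) : R :=
  Series (fun m => A n m * x m).

(** The hypothesis of the Schur test: a symmetric matrix with nonnegative
    entries for which [w] is a positive supersolution, [A w <= C w].  Asking it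
    of partial sums avoids any convergence condition. *)
Definition schur_bounded (A : nat -> nat -> R) (w : nat -> R) (C : R) : Prop :=
  (forall n m, 0 <= A n m) /\ (forall n m, A n m = A m n) /\
  (forall n, 0 < w n) /\
  forall n M, sum_f_R0 (fun m => A n m * w m) M <= C * w n.


Lemma schur_const_nonneg A w C : schur_bounded A w C -> 0 <= C.
Proof.
  intros (H0 & _ & Hw & HC). specialize (HC 0%nat 0%nat). simpl in HC.
  pose proof (H0 0 0)%nat. pose proof (Hw 0%nat). nra.
Qed.

(** The Schur test on rectangular sections, for which no convergence has to be
    known: Cauchy-Schwarz on [A = sqrt (A w) * sqrt (A / w)] spends the bound
    on [A w] once along rows and, after exchanging the sums, once along
    columns. *)
Lemma schur_finite A w C x N M :
  schur_bounded A w C -> sq_summable x ->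
  sum_f_R0 (fun n => sum_f_R0 (fun m => A n m * Rabs (x m)) M ^ 2) N
  <= C ^ 2 * energy x.
Proof.
  intros HS Hx. pose proof (schur_const_nonneg _ _ _ HS) as HC0.
  destruct HS as (H0 & Hs & Hw & HC).
  apply Rle_trans with
    (sum_f_R0 (fun n => C * w n *
       sum_f_R0 (fun m => A n m * (x m ^ 2 / w m)) M) N).
  { apply sum_Rle. intros n _.
    rewrite (sum_eq _ (fun m => sqrt (A n m * w m) *
                         (sqrt (A n m / w m) * Rabs (x m)))).
    2:{ intros m _. pose proof (H0 n m). pose proof (Hw m).
        rewrite <- Rmult_assoc, <- sqrt_mult.
        - replace (A n m * w m * (A n m / w m)) with (A n m * A n m)
            by (field; lra).
          rewrite sqrt_square; auto.
        - apply Rmult_le_pos; lra.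
        - apply Rdiv_le_0_compat; lra. }
    eapply Rle_trans; [apply sum_cauchy_schwarz|].
    apply Rmult_le_compat.
    - apply sum_nonneg; intros; apply pow2_ge_0.
    - apply sum_nonneg; intros; apply pow2_ge_0.
    - eapply Rle_trans; [|apply (HC n M)]. apply sum_Rle. intros m _.
      rewrite pow2_sqrt; [lra|]. pose proof (H0 n m). pose proof (Hw m). nra.
    - apply sum_Rle. intros m _. pose proof (H0 n m). pose proof (Hw m).
      rewrite Rpow_mult_distr, pow2_sqrt, pow2_abs.
      + right. field. lra.
      + apply Rdiv_le_0_compat; lra. }
  rewrite (sum_eq _ (fun n => sum_f_R0 (fun m =>
             C * w n * (A n m * (x m ^ 2 / w m))) M)).
  2:{ intros n _. rewrite <- sum_scal. reflexivity. }
  rewrite sum_exchange.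
  apply Rle_trans with (sum_f_R0 (fun m => C ^ 2 * x m ^ 2) M).
  - apply sum_Rle. intros m _.
    rewrite (sum_eq _ (fun n => C * (x m ^ 2 / w m) * (A m n * w n)))
      by (intros n _; rewrite (Hs n m); ring).
    rewrite sum_scal. specialize (HC m N). pose proof (Hw m).
    apply Rle_trans with (C * (x m ^ 2 / w m) * (C * w m)).
    + apply Rmult_le_compat_l; [|exact HC].
      apply Rmult_le_pos; [exact HC0|].
      apply Rdiv_le_0_compat; [apply pow2_ge_0|lra].
    + right. field. lra.
  - rewrite sum_scal. apply Rmult_le_compat_l; [apply pow2_ge_0|].
    apply sum_sq_le_energy, Hx.
Qed.

(** A single row is controlled by the section that ends with it. *)
Lemma schur_row_abs A w C x n :
  schur_bounded A w C -> sq_summable x ->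
  ex_series (fun m => Rabs (A n m * x m)).
Proof.
  intros HS Hx. pose proof (schur_const_nonneg _ _ _ HS) as HC0.
  assert (HA : forall m, Rabs (A n m * x m) = A n m * Rabs (x m)).
  { intros m. rewrite Rabs_mult, (Rabs_pos_eq (A n m)); [reflexivity|].
    apply HS. }
  apply ex_series_bounded with (1 + C ^ 2 * energy x).
  - intros; apply Rabs_pos.
  - intros M. rewrite (sum_eq _ (fun m => A n m * Rabs (x m)))
      by (intros; apply HA).
    pose proof (schur_finite A w C x n M HS Hx) as H.
    (* The bound 1 + E follows from s ^ 2 <= E, whatever the sign of 1 - s. *)
    assert (H1 : sum_f_R0 (fun m => A n m * Rabs (x m)) M ^ 2 <=
                 sum_f_R0 (fun n => sum_f_R0 (fun m => A n m * Rabs (x m)) M ^ 2) n).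
    { destruct n as [|n]; simpl sum_f_R0; [lra|].
      apply Rle_trans with
        (0 + sum_f_R0 (fun m => A (S n) m * Rabs (x m)) M ^ 2); [lra|].
      apply Rplus_le_compat_r.
      apply (sum_nonneg (fun n => sum_f_R0 (fun m => A n m * Rabs (x m)) M ^ 2)).
      intros; apply pow2_ge_0. }
    nra.
Qed.

Lemma schur_row A w C x n :
  schur_bounded A w C -> sq_summable x -> ex_series (fun m => A n m * x m).
Proof. intros HS Hx. eapply ex_series_Rabs, schur_row_abs; eassumption. Qed.

Lemma schur_partial A w C x N :
  schur_bounded A w C -> sq_summable x ->
  sum_f_R0 (fun n => rmat A x n ^ 2) N <= C ^ 2 * energy x.
Proof.
  intros HS Hx.
  apply (is_lim_seq_le
    (fun M => sum_f_R0 (fun n => sum_f_R0 (fun m => A n m * x m) M ^ 2) N)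
    (fun _ => C ^ 2 * energy x)
    (sum_f_R0 (fun n => rmat A x n ^ 2) N) (C ^ 2 * energy x)).
  - intros M. eapply Rle_trans; [|apply (schur_finite A w C x N M HS Hx)].
    apply sum_Rle. intros n _. apply pow_maj_Rabs.
    eapply Rle_trans; [apply Rsum_abs|]. apply sum_Rle. intros m _.
    rewrite Rabs_mult, (Rabs_pos_eq (A n m)); [lra|apply HS].
  - apply (is_lim_seq_sum
      (fun n M => sum_f_R0 (fun m => A n m * x m) M ^ 2)).
    intros n. simpl.
    assert (L : is_lim_seq (sum_f_R0 (fun m => A n m * x m)) (rmat A x n)).
    { apply Series_lim. eapply schur_row; eassumption. }
    apply (is_lim_seq_mult' _ _ _ _ L).
    apply (is_lim_seq_mult' _ _ _ _ L). apply is_lim_seq_const.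
  - apply is_lim_seq_const.
Qed.

Lemma schur_sq_summable A w C x :
  schur_bounded A w C -> sq_summable x -> sq_summable (rmat A x).
Proof.
  intros HS Hx. eapply ex_series_bounded.
  - intros; apply pow2_ge_0.
  - intros N. eapply schur_partial; eassumption.
Qed.

Lemma schur_energy A w C x :
  schur_bounded A w C -> sq_summable x -> energy (rmat A x) <= C ^ 2 * energy x.
Proof.
  intros HS Hx. apply Series_le_bound.
  - eapply schur_sq_summable; eassumption.
  - intros N. eapply schur_partial; eassumption.
Qed.

Lemma rmat_lincomb A w C c x y n :
  schur_bounded A w C -> sq_summable x -> sq_summable y ->
  rmat A (fun m => c * x m + y m) n = c * rmat A x n + rmat A y n.
Proof.
  intros HS Hx Hy. unfold rmat.
  rewrite <- Series_scal_l, <- Series_plus.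
  - apply Series_ext. intros m. ring.
  - apply (ex_series_scal_l (V := R_NormedModule) c).
    eapply schur_row; eassumption.
  - eapply schur_row; eassumption.
Qed.

Definition truncation (N : nat) (x : nat -> R) (n : nat) : R :=
  if (n <=? N)%nat then x n else 0.

Lemma sq_summable_truncation N x : sq_summable (truncation N x).
Proof.
  exists (sum_f_R0 (fun n => truncation N x n ^ 2) N).
  apply is_series_support. intros n Hn. unfold truncation.
  destruct (Nat.leb_spec n N); [lia|ring].
Qed.

Lemma energy_tail (x : nat -> R) (N : nat) : sq_summable x ->
  energy (fun n => x n - truncation N x n) =
  energy x - sum_f_R0 (fun n => x n ^ 2) N.
Proof.
  intros Hx. unfold energy.
  replace (sum_f_R0 (fun n => x n ^ 2) N) with
    (Series (fun n => truncation N x n ^ 2)).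
  - rewrite <- Series_minus; [|exact Hx|apply sq_summable_truncation].
    apply Series_ext. intros n. unfold truncation.
    destruct (n <=? N)%nat; ring.
  - rewrite (Series_support _ N).
    + apply sum_eq. intros n Hn. unfold truncation.
      destruct (Nat.leb_spec n N); [reflexivity|lia].
    + intros n Hn. unfold truncation. destruct (Nat.leb_spec n N); [lia|ring].
Qed.

Lemma energy_tail_lim (x : nat -> R) : sq_summable x ->
  is_lim_seq (fun N => energy (fun n => x n - truncation N x n)) 0.
Proof.
  intros Hx.
  apply is_lim_seq_ext with (fun N => energy x - sum_f_R0 (fun n => x n ^ 2) N).
  - intros N. symmetry. apply energy_tail, Hx.
  - replace 0 with (energy x - energy x) by ring.
    apply is_lim_seq_minus'; [apply is_lim_seq_const|].
    apply Series_lim, Hx.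
Qed.

(** The bilinear form of the leading square section of [A]. *)
Definition section_form (A : nat -> nat -> R) (x y : nat -> R) (N : nat) : R :=
  sum_f_R0 (fun n => x n * sum_f_R0 (fun m => A n m * y m) N) N.

(** The section of order [N] is the [N]th partial sum of [<x, A y>] with [y]
    truncated; the error is a partial sum of [<x, A t>] with [t] the tail of
    [y], and the Schur bound makes it tend to zero with the energy of [t].
    Symmetry and positivity of [A] are thereby reduced to finite sums. *)
Lemma section_form_lim A w C x y :
  schur_bounded A w C -> sq_summable x -> sq_summable y ->
  is_lim_seq (section_form A x y) (Series (fun n => x n * rmat A y n)).
Proof.
  intros HS Hx Hy.
  set (t := fun N n => y n - truncation N y n).
  assert (Ht : forall N, sq_summable (t N)).
  { intros N. unfold t.
    apply ex_series_eq with (fun n => (-1 * truncation N y n + y n) ^ 2).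
    - intros n. simpl. ring.
    - apply sq_summable_lincomb; [apply sq_summable_truncation|exact Hy]. }
  assert (Hr : forall N n, sum_f_R0 (fun m => A n m * y m) N =
                 rmat A y n - rmat A (t N) n).
  { intros N n.
    assert (E : rmat A (truncation N y) n = sum_f_R0 (fun m => A n m * y m) N).
    { unfold rmat. rewrite (Series_support _ N).
      - apply sum_eq. intros m Hm. unfold truncation.
        destruct (Nat.leb_spec m N); [reflexivity|lia].
      - intros m Hm. unfold truncation. destruct (Nat.leb_spec m N); [lia|ring]. }
    rewrite <- E. replace (rmat A y n) with
      (1 * rmat A (truncation N y) n + rmat A (t N) n); [ring|].
    rewrite <- (rmat_lincomb A w C) by auto using sq_summable_truncation.
    unfold rmat. apply Series_ext. intros m. unfold t. ring. }
  set (e := fun N => sum_f_R0 (fun n => x n * rmat A (t N) n) N).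
  apply is_lim_seq_ext with
    (fun N => sum_f_R0 (fun n => x n * rmat A y n) N - e N).
  { intros N. unfold section_form, e. rewrite <- minus_sum.
    apply sum_eq. intros n _. rewrite Hr. ring. }
  replace (Series (fun n => x n * rmat A y n)) with
    (Series (fun n => x n * rmat A y n) - 0) by ring.
  apply is_lim_seq_minus'.
  { apply Series_lim, ex_series_mult_sq; [exact Hx|].
    eapply schur_sq_summable; eassumption. }
  assert (Hb : forall N, e N ^ 2 <= energy x * C ^ 2 * energy (t N)).
  { intros N. unfold e. eapply Rle_trans; [apply sum_cauchy_schwarz|].
    rewrite Rmult_assoc. apply Rmult_le_compat.
    - apply sum_nonneg; intros; apply pow2_ge_0.
    - apply sum_nonneg; intros; apply pow2_ge_0.
    - apply sum_sq_le_energy, Hx.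
    - eapply schur_partial; [eassumption|apply Ht]. }
  apply is_lim_seq_abs_0.
  apply is_lim_seq_le_le with (fun _ => 0)
    (fun N => sqrt (energy x * C ^ 2 * energy (t N))).
  - intros N. split; [apply Rabs_pos|].
    rewrite <- (sqrt_Rsqr_abs (e N)). apply sqrt_le_1_alt.
    unfold Rsqr. specialize (Hb N). simpl in Hb. lra.
  - apply is_lim_seq_const.
  - rewrite <- sqrt_0. apply is_lim_seq_continuous.
    + apply continuity_pt_sqrt. lra.
    + replace 0 with (energy x * C ^ 2 * 0) by ring.
      apply is_lim_seq_mult'; [apply is_lim_seq_const|].
      apply energy_tail_lim, Hy.
Qed.

Lemma rmat_symmetric A w C x y :
  schur_bounded A w C -> sq_summable x -> sq_summable y ->
  Series (fun n => x n * rmat A y n) = Series (fun n => rmat A x n * y n).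
Proof.
  intros HS Hx Hy.
  rewrite (Series_ext (fun n => rmat A x n * y n) (fun n => y n * rmat A x n))
    by (intros; ring).
  pose proof (section_form_lim A w C x y HS Hx Hy) as H1.
  pose proof (section_form_lim A w C y x HS Hy Hx) as H2.
  apply is_lim_seq_ext with (v := section_form A x y) in H2.
  - apply is_lim_seq_unique in H1. apply is_lim_seq_unique in H2.
    rewrite H1 in H2. injection H2. auto.
  - intros N. unfold section_form.
    rewrite (sum_eq _ (fun n => sum_f_R0 (fun m => y n * (A n m * x m)) N))
      by (intros; rewrite sum_scal; reflexivity).
    rewrite sum_exchange. apply sum_eq. intros m _.
    rewrite <- sum_scal. apply sum_eq. intros n _.
    destruct HS as (_ & Hs & _). rewrite (Hs n m). ring.
Qed.

Lemma rmat_form_nonneg A w C x :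
  schur_bounded A w C -> (forall N, 0 <= section_form A x x N) ->
  sq_summable x -> 0 <= Series (fun n => x n * rmat A x n).
Proof.
  intros HS HP Hx.
  apply (is_lim_seq_le (fun _ => 0) (section_form A x x) 0
           (Series (fun n => x n * rmat A x n)) HP).
  - apply is_lim_seq_const.
  - eapply section_form_lim; eassumption.
Qed.

(** * Green kernels and the tri-diagonal matrices that invert them *)

(** The Green function of a second-order difference operator: [p] solves the
    homogeneous equation with the boundary condition at the left end, [p d] is
    the other solution. *)
Definition green (p d : nat -> R) (n m : nat) : R := p n * p m * d (Nat.max n m).

Definition real_tridiag (a b y : nat -> R) (n : nat) : R :=
  match n with
  | O => b 0%nat * y 0%nat + a 0%nat * y 1%nat
  | S q => a q * y q + b n * y n + a n * y (S n)
  end.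

(** The entries of the tri-diagonal matrix that maps [y] to the increments of
    [flux p d y], divided by [p]. *)
Definition green_coefficients (p d a b : nat -> R) : Prop :=
  (forall n, 0 < p n) /\ (forall n, 0 < d n) /\ (forall n, d (S n) < d n) /\
  (forall n, a n = - / (p n * p (S n) * (d n - d (S n)))) /\
  b 0%nat = / (p 0%nat ^ 2 * (d 0%nat - d 1%nat)) /\
  (forall n, b (S n) =
     (/ (d n - d (S n)) + / (d (S n) - d (S (S n)))) / p (S n) ^ 2).

(** The discrete derivative of [y / p] with respect to [d], the quasi-derivative of
    Sturm-Liouville theory. *)
Definition flux (p d y : nat -> R) (n : nat) : R :=
  (y n / p n - y (S n) / p (S n)) / (d n - d (S n)).

Lemma real_tridiag_flux p d a b y n :
  green_coefficients p d a b ->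
  real_tridiag a b y n =
  (flux p d y n - match n with O => 0 | S q => flux p d y q end) / p n.
Proof.
  intros (Hp & Hd & Hdec & Ha & Hb0 & Hb).
  destruct n as [|n]; unfold real_tridiag, flux.
  - rewrite Ha, Hb0. pose proof (Hp 0%nat). pose proof (Hp 1%nat).
    pose proof (Hdec 0%nat). field. lra.
  - rewrite !Ha, Hb. pose proof (Hp n). pose proof (Hp (S n)).
    pose proof (Hp (S (S n))). pose proof (Hdec n). pose proof (Hdec (S n)).
    field. lra.
Qed.

(** The series for [y n / p n] and [y (n+1) / p (n+1)] differ only in the
    terms [m <= n], where [d (max n m)] is [d n] and [d (n+1)]. *)
Lemma flux_green p d a b w C x n :
  green_coefficients p d a b -> schur_bounded (green p d) w C ->
  sq_summable x ->
  flux p d (rmat (green p d) x) n = sum_f_R0 (fun m => p m * x m) n.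
Proof.
  intros (Hp & Hd & Hdec & _) HS Hx. unfold flux.
  pose proof (Hdec n) as Hn.
  assert (Hg : forall k, rmat (green p d) x k / p k =
                 Series (fun m => p m * d (Nat.max k m) * x m)).
  { intros k. unfold rmat, Rdiv. rewrite <- Series_scal_r.
    apply Series_ext. intros m. unfold green. pose proof (Hp k). field. lra. }
  assert (Hex : forall k, ex_series (fun m => p m * d (Nat.max k m) * x m)).
  { intros k. apply ex_series_eq with (fun m => / p k * (green p d k m * x m)).
    - intros m. unfold green. pose proof (Hp k). field. lra.
    - apply (ex_series_scal_l (V := R_NormedModule) (/ p k)).
      eapply schur_row; eassumption. }
  rewrite !Hg, <- Series_minus by apply Hex.
  rewrite (Series_support _ n).
  - rewrite (sum_eq _ (fun m => (d n - d (S n)) * (p m * x m))).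
    + rewrite sum_scal. field. lra.
    + intros m Hm. rewrite !Nat.max_l by lia. ring.
  - intros m Hm. rewrite !Nat.max_r by lia. ring.
Qed.

Lemma real_tridiag_green p d a b w C x n :
  green_coefficients p d a b -> schur_bounded (green p d) w C ->
  sq_summable x ->
  real_tridiag a b (rmat (green p d) x) n = x n.
Proof.
  intros HG HS Hx. rewrite (real_tridiag_flux p d) by exact HG.
  pose proof (proj1 HG n) as Hp.
  destruct n as [|n].
  - rewrite (flux_green p d a b w C) by assumption. simpl. field. lra.
  - rewrite !(flux_green p d a b w C) by assumption. simpl. field. lra.
Qed.

(** A vanishing second difference makes the flux constant; the first row, which
    has no left neighbour, makes that constant zero, so [y / p] is constant. *)
Lemma real_tridiag_kernel p d a b y :
  green_coefficients p d a b ->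
  (forall n, real_tridiag a b y n = 0) ->
  forall n, y n = y 0%nat / p 0%nat * p n.
Proof.
  intros HG H.
  pose proof HG as (Hp & _ & Hdec & _).
  assert (HF : forall n, flux p d y n = 0).
  { intros n. induction n as [|n IH].
    - specialize (H 0%nat). rewrite (real_tridiag_flux p d) in H by exact HG.
      pose proof (Hp 0%nat).
      replace (flux p d y 0) with ((flux p d y 0 - 0) / p 0%nat * p 0%nat)
        by (field; lra).
      rewrite H. ring.
    - specialize (H (S n)). rewrite (real_tridiag_flux p d) in H by exact HG.
      rewrite IH in H. pose proof (Hp (S n)).
      replace (flux p d y (S n)) with ((flux p d y (S n) - 0) / p (S n) * p (S n))
        by (field; lra).
      rewrite H. ring. }
  intros n. induction n as [|n IH].
  - pose proof (Hp 0%nat). field. lra.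
  - specialize (HF n). unfold flux in HF. pose proof (Hp n).
    pose proof (Hp (S n)). pose proof (Hdec n).
    assert (E : y n / p n - y (S n) / p (S n) = 0).
    { replace (y n / p n - y (S n) / p (S n)) with
        ((y n / p n - y (S n) / p (S n)) / (d n - d (S n)) * (d n - d (S n)))
        by (field; lra).
      rewrite HF. ring. }
    replace (y (S n)) with (y (S n) / p (S n) * p (S n)) by (field; lra).
    replace (y (S n) / p (S n)) with (y n / p n) by lra.
    rewrite IH. field. split; apply Rgt_not_eq, Hp.
Qed.

(** With [s] the partial sums of [p x], passing from [N] to [N+1] adds
    [d (N+1) * (s (N+1)^2 - s N ^2)] to the form; since [d] decreases, the
    form stays above [d N * s N ^2]. *)
Lemma green_section_form_nonneg p d a b x N :
  green_coefficients p d a b -> 0 <= section_form (green p d) x x N.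
Proof.
  intros (Hp & Hd & Hdec & _).
  set (s := sum_f_R0 (fun m => p m * x m)).
  cut (d N * s N ^ 2 <= section_form (green p d) x x N).
  { pose proof (Hd N). pose proof (pow2_ge_0 (s N)). nra. }
  induction N as [|N IH].
  - unfold section_form, s, green. simpl. right. ring.
  - assert (E : section_form (green p d) x x (S N) =
      section_form (green p d) x x N + d (S N) * (s (S N) ^ 2 - s N ^ 2)).
    { assert (E1 : sum_f_R0 (fun n => x n * green p d n (S N) * x (S N)) N =
                   d (S N) * p (S N) * x (S N) * s N).
      { unfold s. rewrite <- sum_scal. apply sum_eq. intros n Hn.
        unfold green. rewrite Nat.max_r by lia. ring. }
      assert (E2 : sum_f_R0 (fun m => green p d (S N) m * x m) N =
                   d (S N) * p (S N) * s N).
      { unfold s. rewrite <- sum_scal. apply sum_eq. intros m Hm.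
        unfold green. rewrite Nat.max_l by lia. ring. }
      unfold section_form at 1. simpl sum_f_R0 at 1.
      rewrite (sum_eq _ (fun n => x n * sum_f_R0 (fun m => green p d n m * x m) N +
                 x n * green p d n (S N) * x (S N)))
        by (intros; simpl; ring).
      rewrite sum_plus, E1. simpl sum_f_R0. rewrite E2.
      fold (section_form (green p d) x x N).
      unfold green. rewrite Nat.max_id. unfold s. simpl. ring. }
    rewrite E. pose proof (Hdec N). pose proof (pow2_ge_0 (s N)). nra.
Qed.

(** * From real to complex sequences *)

Lemma l2_components x :
  l2 x <-> sq_summable (fun n => Re (x n)) /\ sq_summable (fun n => Im (x n)).
Proof.
  unfold l2, sq_summable. split.
  - intros H. split.
    + apply (ex_series_le (V := R_CompleteNormedModule)) with (2 := H).
      intros n. rewrite Cmod2_alt. unfold norm; simpl. unfold abs; simpl.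
      pose proof (pow2_ge_0 (Im (x n))). pose proof (pow2_ge_0 (Re (x n))).
      rewrite Rabs_pos_eq; simpl in *; lra.
    + apply (ex_series_le (V := R_CompleteNormedModule)) with (2 := H).
      intros n. rewrite Cmod2_alt. unfold norm; simpl. unfold abs; simpl.
      pose proof (pow2_ge_0 (Im (x n))). pose proof (pow2_ge_0 (Re (x n))).
      rewrite Rabs_pos_eq; simpl in *; lra.
  - intros [H1 H2]. apply ex_series_eq with
      (fun n => Re (x n) ^ 2 + Im (x n) ^ 2).
    + intros n. symmetry. apply Cmod2_alt.
    + apply (ex_series_plus (V := R_NormedModule)); assumption.
Qed.

Lemma norm2_components x : l2 x ->
  norm2 x = sqrt (energy (fun n => Re (x n)) + energy (fun n => Im (x n))).
Proof.
  intros H. apply l2_components in H. destruct H as [H1 H2].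
  unfold norm2, energy. rewrite <- Series_plus by assumption.
  f_equal. apply Series_ext. intros n. apply Cmod2_alt.
Qed.

Lemma l2_lincomb c x y : l2 x -> l2 y -> l2 (lincomb c x y).
Proof.
  intros Hx Hy. apply l2_components in Hx. apply l2_components in Hy.
  destruct Hx as [Hx1 Hx2], Hy as [Hy1 Hy2]. apply l2_components. split.
  - apply ex_series_eq with (fun n =>
      (Re c * Re (x n) + (- Im c * Im (x n) + Re (y n))) ^ 2).
    + intros n. unfold lincomb, Re, Im. simpl. ring.
    + apply (sq_summable_lincomb (Re c) _
               (fun n => - Im c * Im (x n) + Re (y n)) Hx1).
      apply (sq_summable_lincomb (- Im c) _ _ Hx2 Hy1).
  - apply ex_series_eq with (fun n =>
      (Re c * Im (x n) + (Im c * Re (x n) + Im (y n))) ^ 2).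
    + intros n. unfold lincomb, Re, Im. simpl. ring.
    + apply (sq_summable_lincomb (Re c) _
               (fun n => Im c * Re (x n) + Im (y n)) Hx2).
      apply (sq_summable_lincomb (Im c) _ _ Hx1 Hy2).
Qed.

Lemma l2_zero : l2 (fun _ => RtoC 0).
Proof.
  exists (sum_f_R0 (fun _ => Cmod (RtoC 0) ^ 2) 0). apply is_series_support.
  intros n _. rewrite Cmod_0. ring.
Qed.

Lemma l2_finitely_supported x : finitely_supported x -> l2 x.
Proof.
  intros [N H]. exists (sum_f_R0 (fun n => Cmod (x n) ^ 2) N).
  apply is_series_support. intros n Hn. rewrite H by lia. rewrite Cmod_0. ring.
Qed.

Lemma matrix_components A x n :
  matrix_operator A x n =
  (rmat A (fun m => Re (x m)) n, rmat A (fun m => Im (x m)) n).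
Proof.
  simpl. unfold CSeries, rmat. f_equal; apply Series_ext; intros m;
  unfold Re, Im; simpl; ring.
Qed.

Lemma tridiag_components a b x n :
  tridiag a b x n =
  (real_tridiag a b (fun m => Re (x m)) n, real_tridiag a b (fun m => Im (x m)) n).
Proof.
  destruct n; unfold tridiag, real_tridiag, Re, Im;
  apply injective_projections; simpl; ring.
Qed.

Lemma tridiag_lincomb a b c x y :
  tridiag a b (lincomb c x y) = lincomb c (tridiag a b x) (tridiag a b y).
Proof.
  apply functional_extensionality. intros [|n];
  unfold lincomb, tridiag; ring.
Qed.

(** The topology of the complex plane is that of the product, so convergence of
    both components suffices. *)
Lemma complex_series_components (u : nat -> C) :
  ex_series (fun n => Re (u n)) -> ex_series (fun n => Im (u n)) ->
  ex_series (V := C_R_NormedModule) u.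
Proof.
  intros [l1 H1] [l2 H2]. exists (l1, l2).
  unfold is_series in *.
  apply filterlim_ext with (fun N => (sum_n (fun n => Re (u n)) N,
                                      sum_n (fun n => Im (u n)) N)).
  - intros N. induction N as [|N IH].
    + rewrite !sum_O. destruct (u 0%nat); reflexivity.
    + rewrite !sum_Sn, <- IH. destruct (u (S N)); reflexivity.
  - refine (filterlim_filter_le_2 (G := filter_prod (locally l1) (locally l2))
              _ _ _).
    + intros P [eps HP]. exists (fun x => ball l1 eps x) (fun y => ball l2 eps y).
      * apply locally_ball.
      * apply locally_ball.
      * intros x y Hx Hy. apply HP. split; assumption.
    + apply filterlim_pair; assumption.
Qed.

Lemma bounded_matrix_schur A w C : schur_bounded A w C -> bounded_matrix A.
Proof.
  intros HS.
  assert (HK : forall x, l2 x -> l2 (matrix_operator A x)).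
  { intros x Hx. apply l2_components in Hx. destruct Hx as [H1 H2].
    apply l2_components. split.
    - apply ex_series_eq with (fun n => rmat A (fun m => Re (x m)) n ^ 2).
      + intros n. rewrite matrix_components. reflexivity.
      + eapply schur_sq_summable; eassumption.
    - apply ex_series_eq with (fun n => rmat A (fun m => Im (x m)) n ^ 2).
      + intros n. rewrite matrix_components. reflexivity.
      + eapply schur_sq_summable; eassumption. }
  split; [|split; [split; [|split]|split]].
  - intros x Hx n. apply l2_components in Hx. destruct Hx as [H1 H2].
    apply complex_series_components.
    + apply ex_series_eq with (fun m => A n m * Re (x m)).
      * intros m. unfold Re. simpl. ring.
      * eapply schur_row with (x := fun m => Re (x m)); eassumption.
    + apply ex_series_eq with (fun m => A n m * Im (x m)).
      * intros m. unfold Im. simpl. ring.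
      * eapply schur_row with (x := fun m => Im (x m)); eassumption.
  - intros x Hx. split; [exact Hx|apply HK, Hx].
  - apply l2_zero.
  - intros c x y Hx Hy. split; [apply l2_lincomb; assumption|].
    apply functional_extensionality. intros n. unfold lincomb at 2.
    rewrite !matrix_components.
    apply l2_components in Hx. apply l2_components in Hy.
    destruct Hx as [Hx1 Hx2], Hy as [Hy1 Hy2].
    apply injective_projections; simpl.
    + transitivity (Re c * rmat A (fun m => Re (x m)) n +
        (- Im c * rmat A (fun m => Im (x m)) n + rmat A (fun m => Re (y m)) n));
        [|unfold Re, Im; ring].
      rewrite <- (rmat_lincomb A w C (- Im c)) by assumption.
      rewrite <- (rmat_lincomb A w C (Re c))
        by (try assumption; apply sq_summable_lincomb; assumption).
      unfold rmat. apply Series_ext. intros m. unfold lincomb, Re, Im. simpl. ring.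
    + transitivity (Re c * rmat A (fun m => Im (x m)) n +
        (Im c * rmat A (fun m => Re (x m)) n + rmat A (fun m => Im (y m)) n));
        [|unfold Re, Im; ring].
      rewrite <- (rmat_lincomb A w C (Im c)) by assumption.
      rewrite <- (rmat_lincomb A w C (Re c))
        by (try assumption; apply sq_summable_lincomb; assumption).
      unfold rmat. apply Series_ext. intros m. unfold lincomb, Re, Im. simpl. ring.
  - intros x. split; intros Hx; exact Hx.
  - exists C. intros x Hx. rewrite (norm2_components _ (HK x Hx)).
    rewrite (norm2_components _ Hx).
    apply l2_components in Hx. destruct Hx as [H1 H2].
    rewrite <- (sqrt_pow2 C) by (eapply schur_const_nonneg; eassumption).
    rewrite <- sqrt_mult by
      (try apply pow2_ge_0; apply Rplus_le_le_0_compat; apply energy_nonneg; assumption).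
    apply sqrt_le_1_alt. rewrite Rmult_plus_distr_l.
    apply Rplus_le_compat.
    + eapply Rle_trans; [right|apply (schur_energy A w C _ HS H1)].
      apply Series_ext. intros n. rewrite matrix_components. reflexivity.
    + eapply Rle_trans; [right|apply (schur_energy A w C _ HS H2)].
      apply Series_ext. intros n. rewrite matrix_components. reflexivity.
Qed.

Definition delta (m n : nat) : C := if Nat.eq_dec n m then RtoC 1 else RtoC 0.

Lemma delta_finitely_supported m : finitely_supported (delta m).
Proof.
  exists (S m). intros n Hn. unfold delta.
  destruct (Nat.eq_dec n m); [lia|reflexivity].
Qed.

Lemma matrix_delta A m n : matrix_operator A (delta m) n = RtoC (A n m).
Proof.
  rewrite matrix_components. unfold rmat.
  rewrite (Series_single _ m), (Series_single _ m);
  try (intros k Hk; unfold delta; destruct (Nat.eq_dec k m); [lia|];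
       unfold Re, Im; simpl; ring).
  unfold delta. destruct (Nat.eq_dec m m); [|lia].
  unfold Re, Im. apply injective_projections; simpl; ring.
Qed.

Lemma inner_delta m y : inner (delta m) y = Cconj (y m).
Proof.
  unfold inner, CSeries.
  rewrite (Series_single _ m), (Series_single _ m);
  try (intros k Hk; unfold delta; destruct (Nat.eq_dec k m); [lia|];
       unfold Re, Im; simpl; ring).
  unfold delta. destruct (Nat.eq_dec m m); [|lia].
  unfold Re, Im. apply injective_projections; simpl; ring.
Qed.

Lemma inner_matrix_symmetric A w C x y :
  schur_bounded A w C -> l2 x -> l2 y ->
  inner x (matrix_operator A y) = inner (matrix_operator A x) y.
Proof.
  intros HS Hx Hy. apply l2_components in Hx. apply l2_components in Hy.
  destruct Hx as [Hx1 Hx2], Hy as [Hy1 Hy2].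
  assert (Hm : forall u v, sq_summable u -> sq_summable v ->
                 ex_series (fun n => u n * rmat A v n)).
  { intros u v Hu Hv. apply ex_series_mult_sq; [exact Hu|].
    eapply schur_sq_summable; eassumption. }
  assert (Hm' : forall u v, sq_summable u -> sq_summable v ->
                 ex_series (fun n => rmat A u n * v n)).
  { intros u v Hu Hv. apply ex_series_mult_sq; [|exact Hv].
    eapply schur_sq_summable; eassumption. }
  pose proof (rmat_symmetric A w C _ _ HS Hx1 Hy1) as S11.
  pose proof (rmat_symmetric A w C _ _ HS Hx1 Hy2) as S12.
  pose proof (rmat_symmetric A w C _ _ HS Hx2 Hy1) as S21.
  pose proof (rmat_symmetric A w C _ _ HS Hx2 Hy2) as S22.
  unfold inner, CSeries. f_equal.
  - transitivity
      (Series (fun n => Re (x n) * rmat A (fun m => Re (y m)) n) +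
       Series (fun n => Im (x n) * rmat A (fun m => Im (y m)) n)).
    + rewrite <- Series_plus by (apply Hm; assumption).
      apply Series_ext. intros n.
      rewrite matrix_components. unfold Re, Im. simpl. ring.
    + rewrite S11, S22. rewrite <- Series_plus by (apply Hm'; assumption).
      apply Series_ext. intros n.
      rewrite matrix_components. unfold Re, Im. simpl. ring.
  - transitivity
      (Series (fun n => Im (x n) * rmat A (fun m => Re (y m)) n) -
       Series (fun n => Re (x n) * rmat A (fun m => Im (y m)) n)).
    + rewrite <- Series_minus by (apply Hm; assumption).
      apply Series_ext. intros n.
      rewrite matrix_components. unfold Re, Im. simpl. ring.
    + rewrite S21, S12. rewrite <- Series_minus by (apply Hm'; assumption).
      apply Series_ext. intros n.
      rewrite matrix_components. unfold Re, Im. simpl. ring.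
Qed.

Lemma inner_conj x y : inner y x = Cconj (inner x y).
Proof.
  unfold inner, CSeries, Cconj. apply injective_projections; simpl.
  - apply Series_ext. intros n. unfold Re. simpl. ring.
  - rewrite <- Series_opp. apply Series_ext. intros n. unfold Im. simpl. ring.
Qed.

Lemma finitely_supported_dense x : l2 x -> forall eps, 0 < eps ->
  exists y, finitely_supported y /\ norm2 (fun n => (x n - y n)%C) < eps.
Proof.
  intros Hx eps Heps. pose proof Hx as Hx'.
  apply l2_components in Hx. destruct Hx as [H1 H2].
  set (T := fun (N : nat) n => if (n <=? N)%nat then x n else RtoC 0).
  assert (HT : forall N, finitely_supported (T N)).
  { intros N. exists (S N). intros n Hn. unfold T.
    destruct (Nat.leb_spec n N); [lia|reflexivity]. }
  assert (E : forall N, norm2 (fun n => (x n - T N n)%C) =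
    sqrt (energy (fun n => Re (x n) - truncation N (fun n => Re (x n)) n) +
          energy (fun n => Im (x n) - truncation N (fun n => Im (x n)) n))).
  { intros N.
    assert (HD : l2 (fun n => (x n - T N n)%C)).
    { replace (fun n => (x n - T N n)%C) with (lincomb (- RtoC 1)%C (T N) x).
      - apply l2_lincomb; [apply l2_finitely_supported, HT|exact Hx'].
      - apply functional_extensionality. intros n. unfold lincomb. ring. }
    rewrite norm2_components by exact HD. f_equal. f_equal.
    - apply Series_ext. intros n. unfold T, truncation.
      destruct (n <=? N)%nat; unfold Re; simpl; ring.
    - apply Series_ext. intros n. unfold T, truncation.
      destruct (n <=? N)%nat; unfold Im; simpl; ring. }
  assert (L : is_lim_seq (fun N => norm2 (fun n => (x n - T N n)%C)) 0).
  { apply is_lim_seq_ext with (1 := fun N => eq_sym (E N)).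
    rewrite <- sqrt_0. apply is_lim_seq_continuous.
    - apply continuity_pt_sqrt. lra.
    - replace 0 with (0 + 0) by ring.
      apply is_lim_seq_plus'; apply energy_tail_lim; assumption. }
  apply is_lim_seq_spec in L. destruct (L (mkposreal eps Heps)) as [N HN].
  exists (T N). split; [apply HT|].
  specialize (HN N (Nat.le_refl N)). simpl in HN.
  rewrite Rminus_0_r in HN. eapply Rle_lt_trans; [apply Rle_abs|exact HN].
Qed.

(** [J_alpha alpha] is an instance by definition. *)
Definition maximal_tridiag (a b : nat -> R) : operator :=
  Operator (fun x => l2 x /\ l2 (tridiag a b x)) (tridiag a b).

Lemma tridiag_finitely_supported a b x :
  finitely_supported x -> finitely_supported (tridiag a b x).
Proof.
  intros [N H]. exists (S N). intros [|n] Hn; [lia|].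
  simpl. rewrite !H by lia. ring.
Qed.

(** [G] is a right inverse by the computation with fluxes.  It is a left inverse
    because [G (J y) - y] is square-summable and annihilated by [J], hence a
    multiple of [p], hence zero. *)
Lemma green_inverse p d a b w C :
  green_coefficients p d a b -> schur_bounded (green p d) w C ->
  ~ sq_summable p ->
  is_inverse (maximal_tridiag a b) (matrix_operator (green p d)).
Proof.
  intros HG HS Hp.
  destruct (bounded_matrix_schur _ _ _ HS) as (_ & (HK & _ & HlinK) & _).
  assert (HJK : forall x, l2 x ->
    tridiag a b (matrix_operator (green p d) x) = x).
  { intros x Hx. apply l2_components in Hx. destruct Hx as [H1 H2].
    apply functional_extensionality. intros n. rewrite tridiag_components.
    rewrite (surjective_pairing (x n)).
    f_equal.
    - etransitivity; [|apply (real_tridiag_green p d a b w C _ n HG HS H1)].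
      f_equal. apply functional_extensionality. intros m.
      rewrite matrix_components. reflexivity.
    - etransitivity; [|apply (real_tridiag_green p d a b w C _ n HG HS H2)].
      f_equal. apply functional_extensionality. intros m.
      rewrite matrix_components. reflexivity. }
  assert (HKJ : forall y, l2 y -> l2 (tridiag a b y) ->
    matrix_operator (green p d) (tridiag a b y) = y).
  { intros y Hy HJy.
    set (z := matrix_operator (green p d) (tridiag a b y)).
    assert (Hz : l2 z) by (apply HK, HJy).
    set (r := lincomb (- RtoC 1)%C y z).
    assert (Hr : l2 r) by (apply l2_lincomb; assumption).
    assert (HJr : forall n, tridiag a b r n = RtoC 0).
    { intros n. unfold r. rewrite tridiag_lincomb. unfold lincomb, z.
      rewrite HJK by exact HJy. ring. }
    assert (Hker : forall u, sq_summable u ->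
      (forall n, real_tridiag a b u n = 0) -> forall n, u n = 0).
    { intros u Hu HJu n.
      pose proof (real_tridiag_kernel p d a b u HG HJu) as Hn.
      destruct (Req_dec (u 0%nat) 0) as [E|E].
      - rewrite Hn, E. unfold Rdiv. ring.
      - exfalso. apply Hp. pose proof (proj1 HG 0%nat) as Hp0.
        apply ex_series_eq with (fun n => (p 0%nat / u 0%nat) ^ 2 * u n ^ 2).
        + intros m. rewrite (Hn m). field. split; [lra|exact E].
        + apply (ex_series_scal_l (V := R_NormedModule)), Hu. }
    apply l2_components in Hr. destruct Hr as [Hr1 Hr2].
    assert (R1 := Hker _ Hr1). assert (R2 := Hker _ Hr2).
    apply functional_extensionality. intros n.
    assert (E : r n = RtoC 0).
    { apply injective_projections.
      - apply R1. intros m. specialize (HJr m). rewrite tridiag_components in HJr.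
        injection HJr. auto.
      - apply R2. intros m. specialize (HJr m). rewrite tridiag_components in HJr.
        injection HJr. auto. }
    unfold r, lincomb in E.
    transitivity (- RtoC 1 * y n + z n + y n)%C; [ring|]. rewrite E. ring. }
  split; [|split; [|split; [|split]]].
  - intros x Hx. split; [apply HK, Hx|]. rewrite HJK by exact Hx. exact Hx.
  - intros x y Hx Hy E. rewrite <- (HJK x Hx), <- (HJK y Hy), E. reflexivity.
  - intros y [Hy HJy]. exists (tridiag a b y). split; [exact HJy|].
    apply HKJ; assumption.
  - exact HJK.
  - intros y [Hy HJy]. apply HKJ; assumption.
Qed.

Lemma maximal_tridiag_linear a b : linear_operator (maximal_tridiag a b).
Proof.
  split; [|split].
  - intros x Hx. exact Hx.
  - split; [apply l2_zero|].
    replace (tridiag a b (fun _ => RtoC 0)) with (fun _ : nat => RtoC 0).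
    + apply l2_zero.
    + apply functional_extensionality. intros [|n]; simpl; ring.
  - intros c x y [Hx HJx] [Hy HJy]. simpl. rewrite tridiag_lincomb.
    split; [split|reflexivity]; apply l2_lincomb; assumption.
Qed.

(** If [(y, z)] is in the adjoint graph, testing it on [x = A u] gives
    [<u, y> = <A u, z> = <u, A z>] for all [u], so that [y = A z] lies in the
    domain and is mapped to [z]. *)
Lemma self_adjoint_of_inverse (A : nat -> nat -> R) (a b : nat -> R) w C :
  schur_bounded A w C ->
  is_inverse (maximal_tridiag a b) (matrix_operator A) ->
  self_adjoint (maximal_tridiag a b).
Proof.
  intros HS (HD & _ & Hsurj & HJK & HKJ).
  split; [apply maximal_tridiag_linear|split].
  - intros x Hx eps Heps.
    destruct (finitely_supported_dense x Hx eps Heps) as (y & Hy & Hn).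
    exists y. split; [|exact Hn]. split.
    + apply l2_finitely_supported, Hy.
    + apply l2_finitely_supported, tridiag_finitely_supported, Hy.
  - intros y z. split.
    + intros (Hy & Hz & H).
      assert (E : y = matrix_operator A z).
      { apply functional_extensionality. intros n.
        pose proof (l2_finitely_supported _ (delta_finitely_supported n)) as Hd.
        specialize (H _ (HD _ Hd)). rewrite HJK in H by exact Hd.
        rewrite <- (inner_matrix_symmetric A w C) in H by assumption.
        rewrite !inner_delta in H.
        rewrite <- (Cconj_conj (y n)), H, Cconj_conj. reflexivity. }
      rewrite E. split; [apply HD, Hz|apply HJK, Hz].
    + intros [Hy E]. pose proof Hy as [Hy1 Hy2].
      split; [exact Hy1|split; [rewrite <- E; exact Hy2|]].
      intros x Hx. destruct (Hsurj x Hx) as (u & Hu & Eu).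
      rewrite <- Eu, HJK by exact Hu.
      assert (Hz : l2 z) by (rewrite <- E; exact Hy2).
      rewrite <- (inner_matrix_symmetric A w C) by assumption.
      rewrite <- E, HKJ by exact Hy. reflexivity.
Qed.

(** On the range of [A], [<T (A u), A u> = <u, A u>]. *)
Lemma positive_of_inverse (A : nat -> nat -> R) (T : operator) w C :
  schur_bounded A w C -> (forall x N, 0 <= section_form A x x N) ->
  is_inverse T (matrix_operator A) -> positive_semidefinite T.
Proof.
  intros HS HP (_ & _ & Hsurj & HJK & _) x Hx.
  destruct (Hsurj x Hx) as (u & Hu & Eu).
  rewrite <- Eu, HJK by exact Hu. split.
  - pose proof (inner_matrix_symmetric A w C u u HS Hu Hu) as E.
    rewrite (inner_conj u (matrix_operator A u)) in E.
    destruct (inner u (matrix_operator A u)) as [r i].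
    unfold Cconj in E. simpl in E. injection E. unfold Im. simpl. lra.
  - apply l2_components in Hu. destruct Hu as [H1 H2].
    assert (Hm : forall v, sq_summable v -> ex_series (fun n => v n * rmat A v n)).
    { intros v Hv. apply ex_series_mult_sq; [exact Hv|].
      eapply schur_sq_summable; eassumption. }
    change (Re (inner u (matrix_operator A u))) with
      (Series (fun n => Re (u n * Cconj (matrix_operator A u n))%C)).
    rewrite (Series_ext _ (fun n => Re (u n) * rmat A (fun m => Re (u m)) n +
                                    Im (u n) * rmat A (fun m => Im (u m)) n)).
    2:{ intros n. rewrite matrix_components. unfold Re, Im. simpl. ring. }
    rewrite (Series_plus (fun n => Re (u n) * rmat A (fun m => Re (u m)) n)
               (fun n => Im (u n) * rmat A (fun m => Im (u m)) n))
      by (apply (Hm (fun n => _ (u n))); assumption).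
    apply Rplus_le_le_0_compat.
    + apply (rmat_form_nonneg A w C (fun n => Re (u n))); auto.
    + apply (rmat_form_nonneg A w C (fun n => Im (u n))); auto.
Qed.

(** * Powers of integers *)

Lemma idx_pos n : 0 < idx n.
Proof. apply lt_0_INR. lia. Qed.

Lemma idx_ge_1 n : 1 <= idx n.
Proof. unfold idx. rewrite S_INR. pose proof (pos_INR n). lra. Qed.

Lemma idx_0 : idx 0 = 1.
Proof. reflexivity. Qed.

Lemma idx_S n : idx (S n) = idx n + 1.
Proof. apply S_INR. Qed.

Lemma rpow_pos t s : 0 < t -> rpow t s = Rpower t s.
Proof. intros H. unfold rpow. destruct (Req_EM_T t 0); [lra|reflexivity]. Qed.

Lemma Rpower_pos t s : 0 < Rpower t s.
Proof. apply exp_pos. Qed.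

Lemma Rpower_base_1 s : Rpower 1 s = 1.
Proof. unfold Rpower. rewrite ln_1, Rmult_0_r. apply exp_0. Qed.

Lemma ln_le_sub_1 t : 0 < t -> ln t <= t - 1.
Proof.
  intros H. destruct (Req_dec (ln t) 0) as [E|E].
  - assert (t = 1) by (rewrite <- (exp_ln t H), E; apply exp_0). lra.
  - pose proof (exp_ineq1 _ E) as H1. rewrite exp_ln in H1 by exact H. lra.
Qed.

Lemma ln_succ_ge t : 0 < t -> / (t + 1) <= ln (t + 1) - ln t.
Proof.
  intros Ht. pose proof (ln_le_sub_1 (t / (t + 1))) as H.
  rewrite ln_div in H by lra.
  assert (0 < t / (t + 1)) by (apply Rdiv_lt_0_compat; lra).
  specialize (H H0).
  replace (/ (t + 1)) with (1 - t / (t + 1)) by (field; lra). lra.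
Qed.

Lemma ln_succ_le t : 0 < t -> ln (t + 1) - ln t <= / t.
Proof.
  intros Ht. pose proof (ln_le_sub_1 ((t + 1) / t)) as H.
  rewrite ln_div in H by lra.
  assert (0 < (t + 1) / t) by (apply Rdiv_lt_0_compat; lra).
  specialize (H H0).
  replace (/ t) with ((t + 1) / t - 1) by (field; lra). lra.
Qed.

(** From [(1 + 1/t)^s >= 1 + s * ln (1 + 1/t) >= 1 + s / (t + 1)].  It replaces
    the mean value theorem in comparing sums of powers with telescoping sums,
    and needs no distinction between [s < 1] and [s > 1]. *)
Lemma Rpower_succ_growth t s : 0 < t -> 0 < s ->
  Rpower t s * (t + 1 + s) <= Rpower (t + 1) s * (t + 1).
Proof.
  intros Ht Hs.
  assert (E : Rpower (t + 1) s = Rpower t s * exp (s * (ln (t + 1) - ln t))).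
  { unfold Rpower. rewrite <- exp_plus. f_equal. ring. }
  rewrite E. pose proof (Rpower_pos t s) as Hp.
  pose proof (ln_succ_ge t Ht) as Hl.
  assert (H1 : 1 + s * / (t + 1) <= exp (s * (ln (t + 1) - ln t))).
  { apply Rle_trans with (1 + s * (ln (t + 1) - ln t)).
    - apply Rplus_le_compat_l, Rmult_le_compat_l; lra.
    - apply exp_ineq1_le. }
  rewrite Rmult_assoc. apply Rmult_le_compat_l; [lra|].
  replace (t + 1 + s) with ((1 + s * / (t + 1)) * (t + 1)) by (field; lra).
  apply Rmult_le_compat_r; lra.
Qed.

Lemma power_sum_le s N : 0 < s ->
  sum_f_R0 (fun m => Rpower (idx m) (s - 1)) N <= (1 + s) / s * Rpower (idx N) s.
Proof.
  intros Hs. induction N as [|N IH].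
  - simpl. rewrite idx_0, !Rpower_base_1, Rmult_1_r.
    replace ((1 + s) / s) with (1 + / s) by (field; lra).
    pose proof (Rinv_0_lt_compat s Hs). lra.
  - simpl sum_f_R0. rewrite !idx_S. pose proof (idx_pos N) as Ht.
    set (t := idx N) in *.
    pose proof (Rpower_succ_growth t s Ht Hs) as HG.
    assert (E : Rpower (t + 1) (s - 1) = Rpower (t + 1) s * / (t + 1)).
    { unfold Rminus. rewrite Rpower_plus, Rpower_Ropp, Rpower_1 by lra.
      reflexivity. }
    rewrite E.
    set (X := Rpower t s) in *.
    pose proof (Rpower_pos (t + 1) s) as HY.
    set (Y := Rpower (t + 1) s) in *.
    assert (H1 : Y * / (t + 1) <= (1 + s) / s * (Y - X)).
    { assert (H2 : X <= Y * (t + 1) / (t + 1 + s)).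
      { apply Rle_div_r; lra. }
      apply Rle_trans with ((1 + s) / s * (Y - Y * (t + 1) / (t + 1 + s))).
      - replace ((1 + s) / s * (Y - Y * (t + 1) / (t + 1 + s))) with
          (Y * / (t + 1) + Y * (s * t) / ((t + 1) * (t + 1 + s)))
          by (field; lra).
        assert (0 <= Y * (s * t) / ((t + 1) * (t + 1 + s))).
        { apply Rdiv_le_0_compat; [|apply Rmult_lt_0_compat; lra].
          apply Rmult_le_pos; [lra|]. apply Rmult_le_pos; lra. }
        lra.
      - apply Rmult_le_compat_l; [|lra]. apply Rdiv_le_0_compat; lra. }
    lra.
Qed.

(** The terms of the tail of [sum t^(-s-1)] are dominated by the increments of
    a telescoping series. *)
Lemma power_tail_step t s : 0 < t -> 0 < s ->
  Rpower (t + 1) (- s - 1) <= / s * (Rpower t (- s) - Rpower (t + 1) (- s)).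
Proof.
  intros Ht Hs. pose proof (Rpower_succ_growth t s Ht Hs) as HG.
  unfold Rminus at 1. rewrite Rpower_plus, !Rpower_Ropp, Rpower_1 by lra.
  pose proof (Rpower_pos t s) as HX. pose proof (Rpower_pos (t + 1) s) as HY.
  set (X := Rpower t s) in *. set (Y := Rpower (t + 1) s) in *.
  assert (H : (t + 1 + s) / (Y * (t + 1)) <= / X).
  { apply Rle_div_l; [apply Rmult_lt_0_compat; lra|].
    rewrite Rmult_comm. apply Rle_div_r; [lra|]. lra. }
  replace (/ Y * / (t + 1)) with (/ s * ((t + 1 + s) / (Y * (t + 1)) - / Y))
    by (field; lra).
  apply Rmult_le_compat_l; [left; apply Rinv_0_lt_compat; lra|lra].
Qed.

(** Comparison with the harmonic series, whose partial sums dominate the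
    logarithm. *)
Lemma power_not_sq_summable s :
  - (1 / 2) <= s -> ~ sq_summable (fun n => Rpower (idx n) s).
Proof.
  intros Hs H.
  assert (HL : forall N, ln (idx (S N)) <= energy (fun n => Rpower (idx n) s)).
  { intros N. eapply Rle_trans; [|apply (sum_sq_le_energy _ N H)].
    induction N as [|N IH].
    - simpl sum_f_R0. rewrite idx_S, idx_0, Rpower_base_1.
      pose proof (ln_succ_le 1 Rlt_0_1). rewrite ln_1, Rinv_1 in H0. lra.
    - rewrite tech5, (idx_S (S N)).
      pose proof (ln_succ_le _ (idx_pos (S N))) as H1.
      assert (H2 : / idx (S N) <= Rpower (idx (S N)) s ^ 2).
      { rewrite <- Rpower_pow, Rpower_mult by apply Rpower_pos.
        rewrite <- (Rpower_1 (idx (S N))) at 1 by apply idx_pos.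
        rewrite <- Rpower_Ropp. apply Rle_Rpower.
        - apply idx_ge_1.
        - simpl. lra. }
      lra. }
  destruct (INR_unbounded (exp (energy (fun n => Rpower (idx n) s)))) as [N HN].
  specialize (HL N). apply (Rle_not_lt _ _ HL). apply exp_lt_inv.
  rewrite exp_ln by apply idx_pos. rewrite idx_S.
  assert (idx N = INR N + 1) by apply S_INR. lra.
Qed.

(** * The kernel of the family as a Green kernel *)

Definition power_p (alpha : R) (n : nat) : R := Rpower (idx n) (alpha - 1 / 2).

Definition power_d (alpha : R) (n : nat) : R := Rpower (idx n) (- (2 * alpha)).

Lemma k_alpha_green alpha n m :
  k_alpha alpha (idx n) (idx m) = green (power_p alpha) (power_d alpha) n m.
Proof.
  unfold k_alpha, green, power_p, power_d.
  pose proof (idx_pos n) as Hn. pose proof (idx_pos m) as Hm.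
  assert (E : Rmax (idx n) (idx m) = idx (Nat.max n m)).
  { destruct (Nat.le_ge_cases n m) as [H|H].
    - rewrite Nat.max_r by exact H. apply Rmax_right, le_INR. lia.
    - rewrite Nat.max_l by exact H. apply Rmax_left, le_INR. lia. }
  rewrite E, !rpow_pos by
    (try apply idx_pos; apply Rmult_lt_0_compat; assumption).
  rewrite <- Rpower_mult_distr by assumption. rewrite Rpower_Ropp.
  unfold Rdiv. do 3 f_equal; lra.
Qed.

Lemma kernel_matrix_k_alpha alpha :
  kernel_matrix (k_alpha alpha) = green (power_p alpha) (power_d alpha).
Proof.
  apply functional_extensionality; intros n.
  apply functional_extensionality; intros m. apply k_alpha_green.
Qed.

(** All powers in the coefficients are written through the products
    [power_p alpha n ^ 2 * idx n], so that their identities become rational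
    ones. *)
Lemma power_p_sq alpha n :
  Rpower (idx n) (2 * alpha) = power_p alpha n * power_p alpha n * idx n.
Proof.
  unfold power_p. rewrite <- (Rpower_1 (idx n)) at 4 by apply idx_pos.
  rewrite <- !Rpower_plus. f_equal. lra.
Qed.

Lemma power_d_inv alpha n :
  power_d alpha n = / (power_p alpha n * power_p alpha n * idx n).
Proof. unfold power_d. rewrite Rpower_Ropp, power_p_sq. reflexivity. Qed.

Lemma power_increasing alpha n : 0 < alpha ->
  power_p alpha n * power_p alpha n * idx n <
  power_p alpha (S n) * power_p alpha (S n) * idx (S n).
Proof.
  intros Ha. rewrite <- !power_p_sq. apply Rlt_Rpower_l; [lra|].
  rewrite idx_S. pose proof (idx_pos n). lra.
Qed.

Lemma power_coefficients alpha : 0 < alpha ->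
  green_coefficients (power_p alpha) (power_d alpha)
    (fun n => a_alpha alpha (idx n)) (fun n => b_alpha alpha (idx n)).
Proof.
  intros Ha.
  assert (Hp : forall n, 0 < power_p alpha n) by (intros; apply Rpower_pos).
  assert (Hd : forall n, 0 < power_d alpha n) by (intros; apply Rpower_pos).
  assert (Hq : forall n, Rpower (idx n) (alpha + 1 / 2) = power_p alpha n * idx n).
  { intros n. unfold power_p. rewrite <- (Rpower_1 (idx n)) at 3 by apply idx_pos.
    rewrite <- Rpower_plus. f_equal. lra. }
  assert (Hr : forall n, Rpower (idx n) (2 * alpha + 1) =
                 power_p alpha n * power_p alpha n * idx n * idx n).
  { intros n. rewrite <- power_p_sq, Rpower_plus, Rpower_1 by apply idx_pos.
    reflexivity. }
  split; [exact Hp|split; [exact Hd|split; [|split; [|split]]]].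
  - intros n. rewrite !power_d_inv. apply Rinv_lt_contravar.
    + rewrite <- !power_p_sq. apply Rmult_lt_0_compat; apply Rpower_pos.
    + apply power_increasing, Ha.
  - intros n. unfold a_alpha. rewrite <- idx_S.
    rewrite !rpow_pos by apply idx_pos.
    rewrite !Hq, !power_p_sq, !power_d_inv.
    pose proof (power_increasing alpha n Ha). pose proof (Hp n).
    pose proof (Hp (S n)). pose proof (idx_pos n). pose proof (idx_pos (S n)).
    field. repeat split; lra.
  - unfold b_alpha. rewrite <- idx_S. rewrite idx_0.
    replace (1 - 1) with 0 by ring.
    replace (rpow 0 (2 * alpha)) with 0
      by (unfold rpow; destruct (Req_EM_T 0 0); [reflexivity|lra]).
    rewrite !rpow_pos by (try apply idx_pos; lra). rewrite !Rpower_base_1.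
    rewrite !power_p_sq, !power_d_inv.
    pose proof (power_increasing alpha 0 Ha) as HI.
    assert (E : power_p alpha 0 = 1)
      by (unfold power_p; rewrite idx_0; apply Rpower_base_1).
    rewrite E, idx_0 in *.
    pose proof (Hp 1%nat). pose proof (idx_pos 1). field. repeat split; lra.
  - intros n. unfold b_alpha. rewrite <- idx_S.
    replace (idx (S n) - 1) with (idx n) by (rewrite idx_S; ring).
    rewrite !rpow_pos by apply idx_pos.
    rewrite !Hr, !power_p_sq, !power_d_inv.
    pose proof (power_increasing alpha n Ha).
    pose proof (power_increasing alpha (S n) Ha).
    pose proof (Hp n). pose proof (Hp (S n)). pose proof (Hp (S (S n))).
    pose proof (idx_pos n). pose proof (idx_pos (S n)).
    pose proof (idx_pos (S (S n))).
    field. repeat split; lra.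
Qed.

(** With [w n = n^(-1/2)], the part [m <= n] of the row sum is
    [n^(-alpha-1/2) * sum m^(alpha-1)] and the part [m > n] is
    [n^(alpha-1/2) * sum m^(-alpha-1)]; both are of the order of [w n]. *)
Lemma power_schur alpha : 0 < alpha ->
  schur_bounded (green (power_p alpha) (power_d alpha))
    (fun n => Rpower (idx n) (- (1 / 2))) ((1 + alpha) / alpha + / alpha).
Proof.
  intros Ha. pose proof (Rinv_0_lt_compat alpha Ha) as Hia.
  assert (Hca : 0 < (1 + alpha) / alpha) by (apply Rdiv_lt_0_compat; lra).
  split; [|split; [|split]].
  - intros n m. unfold green. left.
    repeat apply Rmult_lt_0_compat; apply Rpower_pos.
  - intros n m. unfold green. rewrite Nat.max_comm. ring.
  - intros n. apply Rpower_pos.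
  - intros n.
    set (w := fun n => Rpower (idx n) (- (1 / 2))).
    set (F := sum_f_R0 (fun m => green (power_p alpha) (power_d alpha) n m * w m)).
    assert (Hlow : forall M, (M <= n)%nat -> F M <= (1 + alpha) / alpha * w n).
    { intros M HM. unfold F.
      rewrite (sum_eq _ (fun m => power_p alpha n * power_d alpha n *
                                  Rpower (idx m) (alpha - 1))).
      2:{ intros m Hm. unfold green. rewrite Nat.max_l by lia.
          replace (alpha - 1) with (alpha - 1 / 2 + - (1 / 2)) by lra.
          rewrite Rpower_plus. unfold w, power_p. ring. }
      rewrite sum_scal.
      apply Rle_trans with (power_p alpha n * power_d alpha n *
        ((1 + alpha) / alpha * Rpower (idx n) alpha)).
      - apply Rmult_le_compat_l.
        + apply Rmult_le_pos; left; apply Rpower_pos.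
        + eapply Rle_trans; [apply power_sum_le, Ha|].
          apply Rmult_le_compat_l; [lra|]. apply Rle_Rpower_l; [lra|].
          split; [apply idx_pos|apply le_INR; lia].
      - right. unfold w.
        replace (- (1 / 2)) with (alpha - 1 / 2 + (- (2 * alpha) + alpha)) by lra.
        rewrite !Rpower_plus. unfold power_p, power_d. ring. }
    assert (Hhigh : forall j, F (n + j)%nat <= (1 + alpha) / alpha * w n +
              power_p alpha n * / alpha *
              (Rpower (idx n) (- alpha) - Rpower (idx (n + j)) (- alpha))).
    { intros j. induction j as [|j IH].
      - rewrite Nat.add_0_r. pose proof (Hlow n (Nat.le_refl n)).
        rewrite Rminus_diag, Rmult_0_r, Rplus_0_r. assumption.
      - rewrite Nat.add_succ_r. unfold F. simpl sum_f_R0. fold (F (n + j)%nat).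
        assert (E : green (power_p alpha) (power_d alpha) n (S (n + j)) *
                    w (S (n + j)) =
                    power_p alpha n * Rpower (idx (S (n + j))) (- alpha - 1)).
        { unfold green. rewrite Nat.max_r by lia.
          replace (- alpha - 1) with
            (alpha - 1 / 2 + (- (2 * alpha) + - (1 / 2))) by lra.
          rewrite !Rpower_plus. unfold w, power_p, power_d. ring. }
        rewrite E.
        pose proof (power_tail_step (idx (n + j)) alpha (idx_pos _) Ha) as HT.
        rewrite <- idx_S in HT.
        apply (Rmult_le_compat_l (power_p alpha n)) in HT;
          [|left; apply Rpower_pos].
        rewrite <- Rmult_assoc in HT. lra. }
    intros M. fold (F M). change (Rpower (idx n) (- (1 / 2))) with (w n).
    assert (Hw : 0 < w n) by apply Rpower_pos.
    destruct (Nat.le_gt_cases M n) as [H|H].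
    + eapply Rle_trans; [apply Hlow, H|]. nra.
    + replace M with (n + (M - n))%nat by lia.
      eapply Rle_trans; [apply Hhigh|].
      assert (E : power_p alpha n * Rpower (idx n) (- alpha) = w n).
      { unfold power_p, w. rewrite <- Rpower_plus. f_equal. lra. }
      assert (0 < power_p alpha n) by apply Rpower_pos.
      pose proof (Rpower_pos (idx (n + (M - n))) (- alpha)).
      assert (0 <= power_p alpha n * / alpha *
                   Rpower (idx (n + (M - n))) (- alpha)).
      { repeat apply Rmult_le_pos; lra. }
      replace (power_p alpha n * / alpha *
        (Rpower (idx n) (- alpha) - Rpower (idx (n + (M - n))) (- alpha))) with
        (/ alpha * (power_p alpha n * Rpower (idx n) (- alpha)) -
         power_p alpha n * / alpha * Rpower (idx (n + (M - n))) (- alpha)) by ring.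
      rewrite E. lra.
Qed.

Lemma power_p_not_sq_summable alpha : 0 < alpha -> ~ sq_summable (power_p alpha).
Proof. intros Ha. apply power_not_sq_summable. lra. Qed.

(** * Matrices inverse to a Jacobi matrix *)

Definition kron (m n : nat) : R := if Nat.eq_dec n m then 1 else 0.

Definition two_sided_inverse (a b : nat -> R) (A : nat -> nat -> R) : Prop :=
  (forall m n, real_tridiag a b (fun i => A i m) n = kron m n) /\
  (forall n m, real_tridiag a b (fun j => A n j) m = kron n m).

Lemma is_series_kron (A : nat -> R) (c : R) (m : nat) :
  is_series (fun i => A i * (c * kron m i)) (c * A m).
Proof.
  replace (c * A m) with (sum_f_R0 (fun i => A i * (c * kron m i)) m).
  - apply is_series_support. intros n Hn. unfold kron.
    destruct (Nat.eq_dec n m); [lia|ring].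
  - rewrite (sum_single _ m m).
    + unfold kron. destruct (Nat.eq_dec m m); [ring|lia].
    + lia.
    + intros n Hn. unfold kron. destruct (Nat.eq_dec n m); [lia|ring].
Qed.

(** Applying [A] to a column of the tri-diagonal matrix is applying the
    tri-diagonal matrix to a row of [A], by its symmetry. *)
Lemma rmat_tridiag_kron A a b n m :
  rmat A (real_tridiag a b (kron m)) n = real_tridiag a b (fun j => A n j) m.
Proof.
  apply is_series_unique. destruct m as [|m]; simpl.
  - apply (is_series_ext (fun i => plus (A n i * (b 0%nat * kron 0 i))
                                        (A n i * (a 0%nat * kron 1 i)))).
    + intros i. change plus with Rplus. rewrite <- Rmult_plus_distr_l. f_equal.
      unfold real_tridiag, kron. destruct i as [|[|i]];
      repeat destruct Nat.eq_dec; try lia; simpl; ring.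
    + apply (is_series_plus (V := R_NormedModule)); apply is_series_kron.
  - apply (is_series_ext (fun i =>
      plus (plus (A n i * (a m * kron m i)) (A n i * (b (S m) * kron (S m) i)))
           (A n i * (a (S m) * kron (S (S m)) i)))).
    + intros i. change plus with Rplus. rewrite <- !Rmult_plus_distr_l. f_equal.
      unfold real_tridiag, kron. destruct i as [|i];
      repeat destruct Nat.eq_dec; try lia; subst; simpl;
      repeat match goal with H : S _ = S _ |- _ => injection H as H; subst end;
      try lia; ring.
    + repeat apply (is_series_plus (V := R_NormedModule)); apply is_series_kron.
Qed.

Lemma Re_pair (r i : R) : Re (r, i) = r.
Proof. reflexivity. Qed.

Lemma Re_delta m n : Re (delta m n) = kron m n.
Proof. unfold delta, kron. destruct (Nat.eq_dec n m); reflexivity. Qed.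

(** The two halves of the definition of an inverse, tested on unit vectors,
    which lie in the domain of a Jacobi matrix. *)
Lemma jacobi_inverse_relations J A :
  jacobi_matrix J -> is_inverse J (matrix_operator A) ->
  exists a b, (forall n, 0 < a n) /\ two_sided_inverse a b A.
Proof.
  intros (_ & HD & a & b & Ha & HJ) (HKD & _ & _ & HJK & HKJ).
  exists a, b. split; [exact Ha|].
  assert (Hd : forall m, l2 (delta m))
    by (intros; apply l2_finitely_supported, delta_finitely_supported).
  split.
  - intros m n.
    pose proof (HJK _ (Hd m)) as E. rewrite (HJ _ (HKD _ (Hd m))) in E.
    rewrite <- Re_delta, <- E, tridiag_components, Re_pair.
    f_equal. apply functional_extensionality. intros i.
    rewrite matrix_delta. reflexivity.
  - intros n m. pose proof (HD _ (delta_finitely_supported m)) as Hm.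
    pose proof (HKJ _ Hm) as E. rewrite (HJ _ Hm) in E.
    transitivity (kron m n).
    2:{ unfold kron. repeat destruct Nat.eq_dec; try lia; reflexivity. }
    rewrite <- Re_delta, <- E, matrix_components, Re_pair.
    rewrite <- rmat_tridiag_kron. f_equal.
    apply functional_extensionality. intros i. rewrite tridiag_components.
    rewrite Re_pair. f_equal. apply functional_extensionality. intros j.
    symmetry. apply Re_delta.
Qed.

(** Two consecutive values of the solution, so that the three-term recurrence
    becomes structural. *)
Fixpoint null_pair (a b : nat -> R) (n : nat) : R * R :=
  match n with
  | O => (1, - b 0%nat / a 0%nat)
  | S n => let (u, v) := null_pair a b n in
           (v, - (a n * u + b (S n) * v) / a (S n))
  end.

Definition null_solution (a b : nat -> R) (n : nat) : R := fst (null_pair a b n).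

Lemma null_solution_recurrence a b n : (forall n, 0 < a n) ->
  real_tridiag a b (null_solution a b) n = 0.
Proof.
  intros Ha. unfold null_solution. destruct n as [|n]; simpl.
  - pose proof (Ha 0%nat). field. lra.
  - destruct (null_pair a b n) as [u v]. simpl. pose proof (Ha (S n)). field. lra.
Qed.

(** Since no [a n] vanishes, each row of the recurrence determines the next
    entry from the previous ones. *)
Lemma null_solution_unique a b y m : (forall n, 0 < a n) ->
  (forall n, (n < m)%nat -> real_tridiag a b y n = 0) ->
  forall n, (n <= m)%nat -> y n = null_solution a b n * y 0%nat.
Proof.
  intros Ha Hy n Hn. revert Hn.
  induction n as [n IH] using (well_founded_induction Wf_nat.lt_wf). intros Hn.
  destruct n as [|[|n]].
  - unfold null_solution. simpl. ring.
  - specialize (Hy 0%nat ltac:(lia)). pose proof (Ha 0%nat).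
    pose proof (null_solution_recurrence a b 0 Ha) as HP. simpl in Hy, HP.
    assert (E0 : null_solution a b 0 = 1) by reflexivity. rewrite E0 in HP.
    apply Rmult_eq_reg_l with (a 0%nat); [|lra].
    replace (a 0%nat * (null_solution a b 1 * y 0%nat)) with
      ((b 0%nat * 1 + a 0%nat * null_solution a b 1) * y 0%nat
       - b 0%nat * y 0%nat) by ring.
    rewrite HP. lra.
  - specialize (Hy (S n) ltac:(lia)). pose proof (Ha (S n)).
    pose proof (null_solution_recurrence a b (S n) Ha) as HP. simpl in Hy, HP.
    rewrite (IH n), (IH (S n)) in Hy by lia.
    apply Rmult_eq_reg_l with (a (S n)); [|lra].
    replace (a (S n) * (null_solution a b (S (S n)) * y 0%nat)) with
      ((a n * null_solution a b n + b (S n) * null_solution a b (S n)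
        + a (S n) * null_solution a b (S (S n))) * y 0%nat
       - a n * (null_solution a b n * y 0%nat)
       - b (S n) * (null_solution a b (S n) * y 0%nat)) by ring.
    rewrite HP. lra.
Qed.

(** The column [m] solves the homogeneous recurrence in the rows before [m], and
    the row [m] in the columns before [m]. *)
Lemma two_sided_inverse_triangles a b A n m : (forall n, 0 < a n) ->
  two_sided_inverse a b A -> (n <= m)%nat ->
  A n m = null_solution a b n * A 0%nat m /\
  A m n = null_solution a b n * A m 0%nat.
Proof.
  intros Ha [Hcol Hrow] Hnm. split.
  - apply (null_solution_unique a b (fun i => A i m) m); auto.
    intros i Hi. rewrite Hcol. unfold kron. destruct Nat.eq_dec; [lia|reflexivity].
  - apply (null_solution_unique a b (fun j => A m j) m); auto.
    intros i Hi. rewrite Hrow. unfold kron. destruct Nat.eq_dec; [lia|reflexivity].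
Qed.

(** * Completely multiplicative functions *)

Lemma bounded_multiples_nonpos u D :
  (forall j : nat, INR j * u <= D) -> u <= 0.
Proof.
  intros H. destruct (Rle_lt_dec u 0) as [|Hu]; [assumption|exfalso].
  destruct (INR_unbounded (D / u)) as [j Hj].
  specialize (H j). apply Rgt_lt, Rlt_div_l in Hj; lra.
Qed.

(** Take [beta] so that [u n = ln |f n| - beta * ln n] vanishes at [2], hence
    at all powers of [2].  Every [n] lies between consecutive powers of [2], so
    the hypothesis bounds [u] on both sides; but [u] is additive, so
    [j * u n = u (n^j)] is bounded in [j] and [u] is zero. *)
Lemma multiplicative_abs_power (f : nat -> R) (M : R) :
  (forall n, (1 <= n)%nat -> f n <> 0) ->
  (forall m n, (1 <= m)%nat -> (1 <= n)%nat -> f (m * n)%nat = f m * f n) ->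
  (forall n m, (1 <= n)%nat -> (n <= m <= 2 * n)%nat ->
     Rabs (f n) <= M * Rabs (f m)) ->
  exists beta, forall n, (1 <= n)%nat -> Rabs (f n) = Rpower (INR n) beta.
Proof.
  intros Hf Hmul HM.
  assert (Hpos : forall n, (1 <= n)%nat -> 0 < Rabs (f n))
    by (intros; apply Rabs_pos_lt; auto).
  assert (HM0 : 0 < M).
  { pose proof (HM 1%nat 1%nat ltac:(lia) ltac:(lia)) as H.
    pose proof (Hpos 1%nat ltac:(lia)). nra. }
  assert (Hln2 : 0 < ln 2) by (rewrite <- ln_1; apply ln_increasing; lra).
  set (beta := ln (Rabs (f 2%nat)) / ln 2).
  set (u := fun n => ln (Rabs (f n)) - beta * ln (INR n)).
  assert (HI : forall n, (1 <= n)%nat -> 0 < INR n)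
    by (intros; apply lt_0_INR; lia).
  assert (Hu : forall m n, (1 <= m)%nat -> (1 <= n)%nat -> u (m * n)%nat = u m + u n).
  { intros m n Hm Hn. unfold u.
    rewrite Hmul, Rabs_mult, mult_INR, !ln_mult by auto. ring. }
  assert (Hpow : forall n j, (1 <= n)%nat -> (1 <= n ^ j)%nat /\
                    u (n ^ j)%nat = INR j * u n).
  { intros n j Hn. induction j as [|j [IH1 IH2]].
    - simpl. split; [lia|]. pose proof (Hu 1%nat 1%nat ltac:(lia) ltac:(lia)) as H.
      simpl in H. lra.
    - rewrite S_INR. simpl Nat.pow. split; [nia|]. rewrite Hu, IH2 by assumption. ring. }
  assert (Hu2 : u 2%nat = 0).
  { unfold u, beta. replace (INR 2) with 2 by (simpl; ring). field. lra. }
  set (D := Rabs (ln M) + Rabs beta * ln 2).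
  assert (Hstep : forall n m, (1 <= n)%nat -> (n <= m <= 2 * n)%nat -> u n - u m <= D).
  { intros n m Hn Hm. unfold u, D.
    assert (H1 : ln (Rabs (f n)) <= ln M + ln (Rabs (f m))).
    { rewrite <- ln_mult by (auto; apply Hpos; lia).
      apply ln_le; [apply Hpos, Hn|]. apply HM; assumption. }
    assert (H2 : 0 <= ln (INR m) - ln (INR n) <= ln 2).
    { assert (INR n <= INR m) by (apply le_INR; lia).
      assert (INR m <= 2 * INR n).
      { replace (2 * INR n) with (INR (2 * n)) by (rewrite mult_INR; simpl; ring).
        apply le_INR; lia. }
      pose proof (HI n Hn). pose proof (ln_le (INR n) (INR m)).
      pose proof (ln_le (INR m) (2 * INR n)) as H6.
      rewrite ln_mult in H6 by lra. lra. }
    pose proof (Rle_abs (ln M)). pose proof (Rle_abs beta).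
    pose proof (Rabs_pos beta).
    assert (beta * (ln (INR m) - ln (INR n)) <= Rabs beta * ln 2).
    { apply Rle_trans with (Rabs beta * (ln (INR m) - ln (INR n))).
      - apply Rmult_le_compat_r; lra.
      - apply Rmult_le_compat_l; lra. }
    lra. }
  assert (Hbound : forall n, (1 <= n)%nat -> u n <= D /\ - u n <= D).
  { intros n Hn. destruct (Nat.log2_spec n ltac:(lia)) as [L1 L2].
    set (j := Nat.log2 n) in *.
    destruct (Hpow 2%nat j ltac:(lia)) as [P1 E1].
    destruct (Hpow 2%nat (S j) ltac:(lia)) as [P2 E2].
    rewrite Hu2, Rmult_0_r in E1, E2. rewrite Nat.pow_succ_r' in L2, E2.
    pose proof (Hstep n (2 * 2 ^ j)%nat Hn ltac:(lia)).
    pose proof (Hstep (2 ^ j)%nat n P1 ltac:(lia)). lra. }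
  exists beta. intros n Hn.
  assert (E : u n = 0).
  { apply Rle_antisym.
    - apply bounded_multiples_nonpos with D. intros j.
      destruct (Hpow n j Hn) as [P1 E1]. rewrite <- E1. apply Hbound, P1.
    - cut (- u n <= 0); [lra|]. apply bounded_multiples_nonpos with D. intros j.
      destruct (Hpow n j Hn) as [P1 E1].
      replace (INR j * - u n) with (- (INR j * u n)) by ring.
      rewrite <- E1. apply Hbound, P1. }
  unfold u in E. rewrite <- (exp_ln (Rabs (f n))) by (apply Hpos, Hn).
  unfold Rpower. f_equal. lra.
Qed.

(** Eventually constant sign suffices, as [f n] has the sign of
    [f (N * n) * f N]. *)
Lemma multiplicative_pos (f : nat -> R) (N : nat) :
  (1 <= N)%nat -> (forall n, (1 <= n)%nat -> f n <> 0) ->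
  (forall m n, (1 <= m)%nat -> (1 <= n)%nat -> f (m * n)%nat = f m * f n) ->
  (forall n, (N <= n)%nat -> 0 < f n * f (S n)) ->
  forall n, (1 <= n)%nat -> 0 < f n.
Proof.
  intros HN Hf Hmul Hs n Hn.
  assert (H : forall m, (N <= m)%nat -> 0 < f N * f m).
  { intros m Hm. induction Hm as [|m Hm IH].
    - pose proof (Hf N HN). nra.
    - specialize (Hs m Hm). pose proof (Hf m ltac:(lia)).
      assert (0 < (f N * f m) * (f m * f (S m))) by (apply Rmult_lt_0_compat; lra).
      assert (0 < f m * f m) by nra. nra. }
  specialize (H (N * n)%nat ltac:(nia)). rewrite Hmul in H by assumption.
  pose proof (Hf N HN). assert (0 < f N * f N) by nra. nra.
Qed.

(** * Homogeneous kernels inverse to a Jacobi matrix *)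

Definition homogeneous (k : R -> R -> R) : Prop :=
  forall lambda x y, 0 < lambda -> 0 < x -> 0 < y ->
    k (lambda * x) (lambda * y) = / lambda * k x y.

Lemma homogeneous_scale k s n m : homogeneous k ->
  (1 <= s)%nat -> (1 <= n)%nat -> (1 <= m)%nat ->
  k (INR (s * n)) (INR (s * m)) = k (INR n) (INR m) / INR s.
Proof.
  intros H Hs Hn Hm. rewrite !mult_INR, H by (apply lt_0_INR; lia).
  unfold Rdiv. ring.
Qed.

(** If [k 1 1 = 0], all diagonal entries vanish by homogeneity, while the first
    column forces [A 1 0 <> 0].  Then [A 1 1 = 0] makes the null solution vanish
    at [1], hence [A 3 1 = 0]; but [A 3 1] is [A 1 0 / 2], because the
    arguments [(4, 2)] are twice [(2, 1)]. *)
Lemma corner_nonzero k a b :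
  homogeneous k -> (forall n, 0 < a n) ->
  two_sided_inverse a b (kernel_matrix k) -> k 1 1 <> 0.
Proof.
  intros Hk Ha HI Hg.
  set (A := kernel_matrix k) in *.
  assert (A00 : A 0%nat 0%nat = 0) by exact Hg.
  assert (A11 : A 1%nat 1%nat = 0).
  { unfold A, kernel_matrix. change (k (INR (2 * 1)) (INR (2 * 1)) = 0).
    rewrite homogeneous_scale by (auto; lia). change (INR 1) with 1.
    rewrite Hg. unfold Rdiv. ring. }
  assert (A31 : A 3%nat 1%nat = A 1%nat 0%nat / 2).
  { unfold A, kernel_matrix. change (k (INR (2 * 2)) (INR (2 * 1)) =
      k (INR 2) (INR 1) / INR 2).
    rewrite homogeneous_scale by (auto; lia). reflexivity. }
  pose proof (proj1 HI 0%nat 0%nat) as E. unfold kron in E. simpl in E.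
  rewrite A00 in E.
  assert (A10 : A 1%nat 0%nat <> 0).
  { intros Z. rewrite Z in E. lra. }
  destruct (two_sided_inverse_triangles a b A 1 1 Ha HI ltac:(lia)) as [_ E1].
  destruct (two_sided_inverse_triangles a b A 1 3 Ha HI ltac:(lia)) as [_ E3].
  rewrite A11 in E1. symmetry in E1. apply Rmult_integral in E1.
  destruct E1 as [E1|E1]; [|contradiction].
  rewrite E1, A31 in E3. lra.
Qed.

(** Here [f] is the null solution, indexed by the positive integer itself, and
    the diagonal value [k 1 1 / m] eliminates the first row and column of the
    matrix. *)
Lemma homogeneous_inverse_factor k a b :
  homogeneous k -> (forall n, 0 < a n) ->
  two_sided_inverse a b (kernel_matrix k) ->
  exists f : nat -> R, f 1%nat = 1 /\
    (forall n, (1 <= n)%nat -> f n <> 0) /\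
    forall n m, (1 <= n <= m)%nat ->
      k (INR n) (INR m) = k 1 1 * f n / (INR m * f m) /\
      k (INR m) (INR n) = k 1 1 * f n / (INR m * f m).
Proof.
  intros Hk Ha HI. pose proof (corner_nonzero k a b Hk Ha HI) as Hg.
  set (f := fun n => null_solution a b (pred n)).
  assert (HT : forall n m, (1 <= n <= m)%nat ->
    k (INR n) (INR m) = f n * k 1 (INR m) /\
    k (INR m) (INR n) = f n * k (INR m) 1).
  { intros n m Hnm. destruct n as [|n]; [lia|]. destruct m as [|m]; [lia|].
    apply (two_sided_inverse_triangles a b (kernel_matrix k) n m Ha HI). lia. }
  assert (HD : forall m, (1 <= m)%nat -> k (INR m) (INR m) = k 1 1 / INR m).
  { intros m Hm. pose proof (homogeneous_scale k m 1 1 Hk Hm ltac:(lia) ltac:(lia)) as E.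
    rewrite Nat.mul_1_r in E. exact E. }
  assert (Hf : forall n, (1 <= n)%nat -> f n <> 0).
  { intros n Hn Z. destruct (HT n n ltac:(lia)) as [E _].
    rewrite Z, HD, Rmult_0_l in E by exact Hn.
    assert (0 < INR n) by (apply lt_0_INR; lia).
    apply Hg. replace (k 1 1) with (k 1 1 / INR n * INR n) by (field; lra).
    rewrite E. ring. }
  exists f. split; [reflexivity|]. split; [exact Hf|]. intros n m Hnm.
  destruct (HT n m Hnm) as [E1 E2]. rewrite E1, E2.
  destruct (HT m m ltac:(lia)) as [D1 D2]. rewrite HD in D1, D2 by lia.
  assert (0 < INR m) by (apply lt_0_INR; lia).
  pose proof (Hf m ltac:(lia)).
  replace (k 1 1) with (k 1 1 / INR m * INR m) by (field; lra).
  split; [rewrite D1|rewrite D2]; field; split; (assumption || lra).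
Qed.

Lemma continuity_section (k : R -> R -> R) x :
  continuity_2d_pt k x 1 -> continuity_pt (fun t => k t 1) x.
Proof.
  intros H. apply continuity_pt_locally. intros eps.
  destruct (H eps) as [d Hd]. exists d. intros y Hy.
  apply Hd; [exact Hy|]. rewrite Rminus_diag, Rabs_R0. apply cond_pos.
Qed.

(** Homogeneity turns [k (n, m)] into [k (n / m, 1)], so that [f n / f m] is the
    value at [n / m] of a function continuous on the positive half-line and
    equal to [1] at [1]. *)
Lemma homogeneous_inverse_power k a b :
  (forall x y, 0 < x -> 0 < y -> continuity_2d_pt k x y) ->
  homogeneous k -> (forall n, 0 < a n) ->
  two_sided_inverse a b (kernel_matrix k) ->
  exists beta, forall n m, (1 <= n <= m)%nat ->
    k (INR n) (INR m) = k 1 1 * (Rpower (INR n) beta * Rpower (INR m) (- 1 - beta)) /\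
    k (INR m) (INR n) = k 1 1 * (Rpower (INR n) beta * Rpower (INR m) (- 1 - beta)).
Proof.
  intros Hc Hk Ha HI. pose proof (corner_nonzero k a b Hk Ha HI) as Hg.
  destruct (homogeneous_inverse_factor k a b Hk Ha HI) as (f & Hf1 & Hf & HF).
  assert (HP : forall n, (1 <= n)%nat -> 0 < INR n)
    by (intros; apply lt_0_INR; lia).
  assert (Hmul : forall m n, (1 <= m)%nat -> (1 <= n)%nat ->
            f (m * n)%nat = f m * f n).
  { intros m n Hm Hn.
    pose proof (homogeneous_scale k m 1 n Hk Hm ltac:(lia) Hn) as E.
    rewrite Nat.mul_1_r in E.
    destruct (HF m (m * n)%nat ltac:(nia)) as [E1 _].
    destruct (HF 1%nat n ltac:(lia)) as [E2 _].
    rewrite E1, E2 in E. rewrite mult_INR in E.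
    rewrite Hf1 in E.
    pose proof (HP m Hm). pose proof (HP n Hn). pose proof (Hf m Hm).
    pose proof (Hf n Hn). pose proof (Hf (m * n)%nat ltac:(nia)).
    apply Rmult_eq_reg_r with (k 1 1 / (INR m * INR n * f (m * n)%nat * f n)).
    2:{ apply Rmult_integral_contrapositive. split; [exact Hg|].
        apply Rinv_neq_0_compat. repeat apply Rmult_integral_contrapositive_currified;
        (assumption || lra). }
    transitivity (k 1 1 * 1 / (INR n * f n) / INR m).
    - field. repeat split; (assumption || lra).
    - rewrite <- E. field. repeat split; (assumption || lra). }
  assert (Hh : forall n m, (1 <= n <= m)%nat ->
            k (INR n / INR m) 1 = k 1 1 * (f n / f m)).
  { intros n m Hnm. pose proof (HP n ltac:(lia)). pose proof (HP m ltac:(lia)).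
    pose proof (Hf m ltac:(lia)).
    replace (INR n / INR m) with (/ INR m * INR n) by (field; lra).
    replace 1 with (/ INR m * INR m) at 1 by (field; lra).
    rewrite Hk by (try assumption; apply Rinv_0_lt_compat; lra).
    rewrite (proj1 (HF n m Hnm)). field. repeat split; (assumption || lra). }
  assert (Hcont : forall x, 0 < x -> continuity_pt (fun t => k t 1) x).
  { intros x Hx. apply continuity_section, Hc; lra. }
  (* For n <= m <= 2 n the quotient n / m stays in the interval [1/2, 1]. *)
  destruct (continuity_ab_maj (fun t => Rabs (k t 1)) (1 / 2) 1) as (x0 & Hx0 & _).
  { lra. }
  { intros x Hx. apply (continuity_pt_comp (fun t => k t 1) Rabs).
    - apply Hcont. lra.
    - apply Rcontinuity_abs. }
  destruct (multiplicative_abs_power f (Rabs (k x0 1) / Rabs (k 1 1)) Hf Hmul)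
    as [beta Hbeta].
  { intros n m Hn Hnm. pose proof (HP n Hn). pose proof (HP m ltac:(lia)).
    pose proof (Hf m ltac:(lia)) as Hfm.
    assert (Hr : 1 / 2 <= INR n / INR m <= 1).
    { assert (INR n <= INR m) by (apply le_INR; lia).
      assert (INR m <= 2 * INR n).
      { replace (2 * INR n) with (INR (2 * n)) by (rewrite mult_INR; simpl; ring).
        apply le_INR; lia. }
      split.
      - apply (proj1 (Rle_div_r (1 / 2) (INR n) (INR m) ltac:(lra))). lra.
      - apply (proj2 (Rle_div_l (INR n) 1 (INR m) ltac:(lra))). lra. }
    specialize (Hx0 _ Hr). rewrite Hh in Hx0 by lia.
    rewrite Rabs_mult, Rabs_div in Hx0 by exact Hfm.
    pose proof (Rabs_pos_lt _ Hg). pose proof (Rabs_pos_lt _ Hfm).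
    apply Rmult_le_reg_l with (Rabs (k 1 1) / Rabs (f m)).
    - apply Rdiv_lt_0_compat; lra.
    - replace (Rabs (k 1 1) / Rabs (f m) * Rabs (f n)) with
        (Rabs (k 1 1) * (Rabs (f n) / Rabs (f m))) by (field; lra).
      eapply Rle_trans; [exact Hx0|]. right. field. split; (assumption || lra). }
  assert (Hsign : forall n, (1 <= n)%nat -> 0 < f n).
  { assert (Heps : 0 < Rabs (k 1 1)) by (apply Rabs_pos_lt, Hg).
    pose proof (proj1 (continuity_pt_locally _ _) (Hcont 1 Rlt_0_1)
                  (mkposreal _ Heps)) as [d Hd].
    destruct (INR_unbounded (/ d)) as [N HN].
    apply (multiplicative_pos f (S N)); auto; [lia|].
    intros n Hn. pose proof (HP n ltac:(lia)) as Hn0.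
    pose proof (cond_pos d) as Hd0.
    assert (Hnd : / (INR n + 1) < d).
    { rewrite <- (Rinv_inv d). apply Rinv_lt_contravar.
      - apply Rmult_lt_0_compat; [apply Rinv_0_lt_compat, Hd0|lra].
      - assert (INR N <= INR n) by (apply le_INR; lia). lra. }
    pose proof (Hd (INR n / INR (S n))) as H.
    rewrite Hh in H by lia.
    assert (Hb : ball 1 d (INR n / INR (S n))).
    { change (Rabs (INR n / INR (S n) - 1) < d). rewrite S_INR.
      replace (INR n / (INR n + 1) - 1) with (- / (INR n + 1)) by (field; lra).
      rewrite Rabs_Ropp, Rabs_pos_eq; [exact Hnd|].
      left. apply Rinv_0_lt_compat. lra. }
    specialize (H Hb). simpl in H.
    replace (k 1 1 * (f n / f (S n)) - k 1 1) with
      (k 1 1 * (f n / f (S n) - 1)) in H by ring.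
    rewrite Rabs_mult in H.
    assert (H1 : Rabs (f n / f (S n) - 1) < 1).
    { apply Rmult_lt_reg_l with (Rabs (k 1 1)); lra. }
    apply Rabs_def2 in H1.
    pose proof (Hf (S n) ltac:(lia)) as Hfs.
    replace (f n * f (S n)) with (f n / f (S n) * (f (S n) * f (S n)))
      by (field; exact Hfs).
    apply Rmult_lt_0_compat; [lra|]. nra. }
  exists beta. intros n m Hnm.
  destruct (HF n m Hnm) as [E1 E2]. rewrite E1, E2.
  pose proof (HP m ltac:(lia)).
  assert (Ef : forall j, (1 <= j)%nat -> f j = Rpower (INR j) beta).
  { intros j Hj. rewrite <- Hbeta by exact Hj.
    rewrite Rabs_pos_eq; [reflexivity|left; apply Hsign, Hj]. }
  rewrite (Ef n), (Ef m) by lia.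
  replace (- 1 - beta) with (- (1) + - beta) by ring.
  rewrite Rpower_plus, !Rpower_Ropp, Rpower_1 by assumption.
  pose proof (Rpower_pos (INR m) beta).
  split; field; split; (assumption || lra).
Qed.

(** With [f n = n^beta], the kernel is [k 1 1 * K_alpha] for
    [alpha = beta + 1/2]; the two sign conditions come from the first column
    and from the corner of order two. *)
Lemma homogeneous_inverse_k_alpha k a b :
  (forall x y, 0 < x -> 0 < y -> continuity_2d_pt k x y) ->
  homogeneous k -> (forall n, 0 < a n) ->
  two_sided_inverse a b (kernel_matrix k) ->
  sq_summable (fun n => kernel_matrix k n 0) ->
  exists alpha c, 0 < alpha /\ c < 0 /\
    forall n m, kernel_matrix k n m = c * kernel_matrix (k_alpha alpha) n m.
Proof.
  intros Hc Hk Ha HI HS.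
  pose proof (corner_nonzero k a b Hk Ha HI) as Hg.
  destruct (homogeneous_inverse_power k a b Hc Hk Ha HI) as [beta HB].
  assert (Halpha : 0 < beta + 1 / 2).
  { destruct (Rlt_le_dec 0 (beta + 1 / 2)) as [|Hle]; [assumption|exfalso].
    apply (power_not_sq_summable (- 1 - beta)); [lra|].
    apply ex_series_eq with (fun n => / k 1 1 ^ 2 * kernel_matrix k n 0 ^ 2).
    - intros n. unfold kernel_matrix.
      destruct (HB 1%nat (S n) ltac:(lia)) as [_ E].
      change (INR 1) with 1 in E. rewrite Rpower_base_1 in E.
      change (idx 0) with 1. unfold idx. rewrite E. field. exact Hg.
    - apply (ex_series_scal_l (V := R_NormedModule)), HS. }
  exists (beta + 1 / 2), (k 1 1). split; [exact Halpha|].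
  assert (Hform : forall n m,
    kernel_matrix k n m = k 1 1 * kernel_matrix (k_alpha (beta + 1 / 2)) n m).
  { intros n m. rewrite kernel_matrix_k_alpha.
    unfold green, power_p, power_d.
    replace (beta + 1 / 2 - 1 / 2) with beta by ring.
    unfold kernel_matrix, idx. destruct (Nat.le_ge_cases n m) as [H|H].
    - rewrite (proj1 (HB (S n) (S m) ltac:(lia))), Nat.max_r by exact H.
      replace (- 1 - beta) with (beta + - (2 * (beta + 1 / 2))) by lra.
      rewrite Rpower_plus. ring.
    - rewrite (proj2 (HB (S m) (S n) ltac:(lia))), Nat.max_l by exact H.
      replace (- 1 - beta) with (beta + - (2 * (beta + 1 / 2))) by lra.
      rewrite Rpower_plus. ring. }
  split; [|exact Hform].
  (* The corner reads g b + g r a = 1 and r b + a / 2 = 0 with g = k 1 1, hence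
     r = g a (r^2 - 1/2); and r^2 < 1/2 because alpha > 0. *)
  set (r := Rpower 2 (- 1 - beta)).
  assert (Hr0 : 0 < r) by apply Rpower_pos.
  assert (Hr1 : r * r < / 2).
  { unfold r. rewrite <- Rpower_plus.
    rewrite <- (Rpower_1 2) at 2 by lra. rewrite <- Rpower_Ropp.
    apply Rpower_lt; lra. }
  destruct (HB 1%nat 2%nat ltac:(lia)) as [K12 K21].
  change (INR 1) with 1 in K12, K21. rewrite Rpower_base_1 in K12, K21.
  replace (INR 2) with 2 in K12, K21 by (simpl; ring). fold r in K12, K21.
  assert (K22 : k 2 2 = k 1 1 / 2).
  { pose proof (Hk 2 1 1 ltac:(lra) ltac:(lra) ltac:(lra)) as E.
    rewrite Rmult_1_r in E. rewrite E. field. }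
  pose proof (proj1 HI 0%nat 0%nat) as E0. pose proof (proj1 HI 1%nat 0%nat) as E1.
  unfold kron, kernel_matrix in E0, E1. simpl in E0, E1.
  change (idx 0) with 1 in E0, E1. change (idx 1) with 2 in E0, E1.
  rewrite K21 in E0. rewrite K12, K22 in E1.
  pose proof (Ha 0%nat) as Ha0.
  assert (E2 : b 0%nat * r = - a 0%nat / 2).
  { apply Rmult_eq_reg_l with (k 1 1); [|exact Hg]. lra. }
  assert (E3 : r = k 1 1 * (a 0%nat * (r * r - / 2))).
  { transitivity (r * (b 0%nat * k 1 1 + a 0%nat * (k 1 1 * (1 * r)))).
    - rewrite E0. ring.
    - transitivity (k 1 1 * (b 0%nat * r + a 0%nat * (r * r))); [ring|].
      rewrite E2. field. }
  assert (H : 0 < a 0%nat * (/ 2 - r * r)) by (apply Rmult_lt_0_compat; lra).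
  nra.
Qed.

Theorem theoremC :
  (forall alpha : R, 0 < alpha ->
     self_adjoint (J_alpha alpha) /\ positive_semidefinite (J_alpha alpha)) /\
  (forall alpha : R, 0 < alpha ->
     bounded_matrix (kernel_matrix (k_alpha alpha)) /\
     is_inverse (J_alpha alpha) (K_alpha alpha)) /\
  (forall k : R -> R -> R,
     (forall x y, 0 < x -> 0 < y -> continuity_2d_pt k x y) ->
     (forall lambda x y, 0 < lambda -> 0 < x -> 0 < y ->
        k (lambda * x) (lambda * y) = / lambda * k x y) ->
     bounded_matrix (kernel_matrix k) ->
     (exists J : operator,
        jacobi_matrix J /\ is_inverse J (matrix_operator (kernel_matrix k))) ->
     exists alpha c : R, 0 < alpha /\ c < 0 /\
       forall x, l2 x ->
         matrix_operator (kernel_matrix k) x =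
         (fun n => (RtoC c * K_alpha alpha x n)%C)).
Proof.
  assert (Hinv : forall alpha, 0 < alpha ->
            is_inverse (J_alpha alpha) (K_alpha alpha)).
  { intros alpha Ha. unfold K_alpha. rewrite kernel_matrix_k_alpha.
    eapply green_inverse.
    - apply power_coefficients, Ha.
    - apply power_schur, Ha.
    - apply power_p_not_sq_summable, Ha. }
  split; [|split].
  - intros alpha Ha. pose proof (Hinv alpha Ha) as HI.
    unfold K_alpha in HI. rewrite kernel_matrix_k_alpha in HI. split.
    + eapply self_adjoint_of_inverse; [apply power_schur, Ha|exact HI].
    + eapply positive_of_inverse; [apply power_schur, Ha| |exact HI].
      intros x N. eapply green_section_form_nonneg, power_coefficients, Ha.
  - intros alpha Ha. split; [|apply Hinv, Ha].
    rewrite kernel_matrix_k_alpha.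
    eapply bounded_matrix_schur, power_schur, Ha.
  - intros k Hc Hk (_ & (HK & _) & _) (J & HJ & HI).
    destruct (jacobi_inverse_relations J _ HJ HI) as (a & b & Ha & HR).
    destruct (homogeneous_inverse_k_alpha k a b Hc Hk Ha HR)
      as (alpha & c & Halpha & Hneg & HE).
    { destruct (HK (delta 0)) as [_ H].
      - apply l2_finitely_supported, delta_finitely_supported.
      - apply l2_components in H. destruct H as [H _].
        apply ex_series_eq with (2 := H). intros n.
        rewrite matrix_delta. reflexivity. }
    exists alpha, c. split; [exact Halpha|]. split; [exact Hneg|].
    intros x _. apply functional_extensionality. intros n.
    unfold K_alpha. rewrite !matrix_components.
    assert (E : forall u, rmat (kernel_matrix k) u n =
                  c * rmat (kernel_matrix (k_alpha alpha)) u n).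
    { intros u. unfold rmat. rewrite <- Series_scal_l. apply Series_ext.
      intros m. rewrite HE. ring. }
    rewrite !E. apply injective_projections; simpl; ring.
Qed.
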